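(* Let $T>0$, $h\in(0,1]$, and let $p\ge 2$ be an integer, $\gamma\in(0,1/p]$, and $V\in\hat{\mathcal V}^p_\gamma$. Let $\{\bar X_k\}$ be the scheme $$\bar X_{k+1}=\bar X_k+b^h(t_k,\bar X_k)h+\sigma^h(t_k,\bar X_k)\Delta W_{k+1},\qquad \bar X_0=X_0,$$ on $[0,T]$. Suppose that $\mathbb E V(X_0)<\infty$, that for some $\rho>0$ $$\mathcal L^hV(x)\le\rho(1+V(x)),\qquad \forall t\in[0,T],\ x\in\mathbb R^d,$$ and that there is $\mu>0$ such that $$|b^h(t,x)|\,h^{1/2}\vee\|\sigma^h(t,x)\|\,h^{1/4}\le\mu(1+V(x))^\gamma,\qquad\forall t\in[0,T],\ x\in\mathbb R^d .$$ Then there exists a constant $\tilde\rho=\tilde\rho(\mu)$ such that $$\mathbb E V(\bar X_k)\le e^{(\rho+\tilde\rho)T}\,\mathbb E(1+V(X_0))<\infty,\qquad\forall\,0\le k\le\lfloor T/h\rfloor .$$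
   Context: $(\Omega,\mathcal F,\mathbb P)$ is a complete probability space with right-continuous filtration $(\mathcal F_t)$; $W$ is an $m$-dimensional $(\mathcal F_t)$-Wiener process; $X_0$ is an $\mathcal F_0$-measurable $\mathbb R^d$-valued random variable; $t_k=kh$, $\Delta W_{k+1}=W_{t_{k+1}}-W_{t_k}$. The tamed coefficients $b^h:[0,T]\times\mathbb R^d\to\mathbb R^d$ and $\sigma^h:[0,T]\times\mathbb R^d\to\mathbb R^{d\times m}$ are measurable functions; $\|\cdot\|$ is the Hilbert–Schmidt norm; $a\vee b=\max(a,b)$. For integers $p\ge2$ and $0<\gamma\le 1/p$, $\mathcal V^p_\gamma$ is the set of $V\in\mathcal C^{p+1}(\mathbb R^d)$ with $V\ge0$, $V(x)=0$ iff $x=0$, and for which there is $c>0$ with $\|V^{(s)}(x)\|_{HS}\le c(1+V(x))^{1-s\gamma}$ for all $x\in\mathbb R^d$ and all $s\le p$, where $V^{(s)}$ is the $s$-th derivative tensor. $\hat{\mathcal V}^p_\gamma=\mathcal V^p_\gamma\cap\{V:\ V^{(p+1)}\equiv0\}$. $\mathcal L^hV(x)=\langle\nabla V(x),b^h(t,x)\rangle+\frac12\mathrm{tr}\left[V^{(2)}(x)\sigma^h(t,x)\sigma^h(t,x)^\top\right]$, with the dependence on $t$ suppressed in the notation. The notation $\tilde\rho(\mu)$ means that $\tilde\rho$ depends on $\mu$ (and on $V,p,\gamma,d,m$) but not on $h$ or $k$. *)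

(* Defs.v *)
From HB Require Import structures.
From mathcomp Require Import all_boot all_order all_algebra.
From mathcomp Require Import all_classical all_reals all_analysis.

Set Implicit Arguments.
Unset Strict Implicit.
Unset Printing Implicit Defensive.

Import Order.TTheory GRing.Theory Num.Theory.
Import numFieldNormedType.Exports.

Local Open Scope classical_set_scope.
Local Open Scope ring_scope.

(* Matrices carry no canonical sigma-algebra in the library; this alias
   carries the Borel one (the topology is the usual one, entrywise). *)
Definition borelMx (R : realType) (m n : nat) :=
  g_sigma_algebraType (@open 'M[R]_(m, n)).

(* Euclidean norm on columns, Hilbert-Schmidt norm on matrices; the norm
   `|A| of the library is the maximum norm. *)
Definition hsnorm (R : realType) (m n : nat) (A : 'M[R]_(m, n)) : R :=
  Num.sqrt (\sum_(i < m) \sum_(j < n) A i j ^+ 2).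

Section derivatives.
Context {R : realType} {d : nat}.
Implicit Types (V : 'cV[R]_d -> R) (x : 'cV[R]_d).

(* iter_partial V [:: i1; ...; is] is the iterated partial derivative
   d_i1 ... d_is V, i.e. the (i1, ..., is) entry of the tensor V^(s). *)
Definition iter_partial V (s : seq 'I_d) : 'cV[R]_d -> R :=
  foldr (fun i (f : 'cV[R]_d -> R) x => 'D_(delta_mx i 0) f x) V s.

Definition class_C (n : nat) V : Prop :=
  forall s : seq 'I_d, (size s <= n)%N ->
    continuous (iter_partial V s) /\
    ((size s < n)%N ->
      forall i x, derivable (iter_partial V s) x (delta_mx i 0)).

Definition tensor_hsnorm V (s : nat) x : R :=
  Num.sqrt (\sum_(i : s.-tuple 'I_d) iter_partial V i x ^+ 2).

Definition calV (p : nat) (gamma : R) V : Prop :=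
  [/\ class_C p.+1 V,
      forall x, 0 <= V x,
      forall x, V x = 0 <-> x = 0 &
      exists2 c : R, 0 < c &
        forall (x : 'cV[R]_d) (s : nat), (s <= p)%N ->
          tensor_hsnorm V s x <= c * (1 + V x) `^ (1 - s%:R * gamma)].

Definition hat_calV (p : nat) (gamma : R) V : Prop :=
  calV p gamma V /\
  forall x (i : p.+1.-tuple 'I_d), iter_partial V i x = 0.

Definition gradV V x : 'cV[R]_d := \col_i iter_partial V [:: i] x.

Definition hessianV V x : 'M[R]_d := \matrix_(i, j) iter_partial V [:: i; j] x.

Definition generator (m : nat) (b : R -> 'cV[R]_d -> 'cV[R]_d)
    (sigma : R -> 'cV[R]_d -> 'M[R]_(d, m)) V (t : R) x : R :=
  \sum_(i < d) gradV V x i 0 * b t x i 0 +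
  2^-1 * \tr (hessianV V x *m sigma t x *m (sigma t x)^T).

End derivatives.

Section stochastic_basis.
Context {dO : measure_display} {Omega : measurableType dO} {R : realType}.
Implicit Types (P : probability Omega R) (F : R -> set (set Omega)).

(* Time is [0, +oo[: the values of F and W at negative times are irrelevant. *)
Definition filtration F : Prop :=
  [/\ forall t : R, 0 <= t -> sigma_algebra setT (F t),
      forall t : R, 0 <= t -> F t `<=` measurable &
      forall s t : R, 0 <= s -> s <= t -> F s `<=` F t].

Definition right_continuous_filtration F : Prop :=
  forall t : R, 0 <= t -> F t = \bigcap_(s in [set s | t < s]) F s.

Definition measurable_wrt (G : set (set Omega)) (n : nat)
    (X : Omega -> 'cV[R]_n) : Prop :=
  forall B : set (borelMx R n 1), measurable B -> G (X @^-1` B).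

(* For s < t the increment has law N(0, (t - s) I_m); this is expressed on
   boxes, which determine a law on R^m. The second parameter of normal_prob
   is the standard deviation. *)
Record wiener_process (m : nat) P F (W : R -> Omega -> 'cV[R]_m) : Prop := {
  wiener_adapted : forall t : R, 0 <= t -> measurable_wrt (F t) (W t) ;
  wiener_start : {ae P, forall w, W 0 w = 0} ;
  wiener_indep : forall s t : R, 0 <= s -> s <= t ->
    forall (A : set Omega) (B : set (borelMx R m 1)), F s A -> measurable B ->
      P (A `&` (W t \- W s) @^-1` B) = (P A * P ((W t \- W s)%R @^-1` B))%E ;
  wiener_normal : forall s t : R, 0 <= s -> s < t ->
    forall B : 'I_m -> set R, (forall i, measurable (B i)) ->
      P [set w | forall i, B i ((W t \- W s) w i 0)] =
      (\prod_(i < m) normal_prob 0 (Num.sqrt (t - s)) (B i))%E ;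
  wiener_continuous :
    {ae P, forall w, {within `[0, +oo[, continuous (fun t => W t w)}}
}.

End stochastic_basis.

Fixpoint scheme {R : realType} {Omega : Type} {d m : nat} (h : R)
    (b : R -> 'cV[R]_d -> 'cV[R]_d)
    (sigma : R -> 'cV[R]_d -> 'M[R]_(d, m))
    (W : R -> Omega -> 'cV[R]_m) (X0 : Omega -> 'cV[R]_d)
    (k : nat) (w : Omega) : 'cV[R]_d :=
  if k is j.+1 then
    let x := scheme h b sigma W X0 j w in
    x + h *: b (j%:R * h) x
      + sigma (j%:R * h) x *m (W (j.+1%:R * h) w - W (j%:R * h) w)
  else X0 w.

(* Main.v *)
Require Import Defs.
From HB Require Import structures.
From mathcomp Require Import all_boot all_order all_algebra.
From mathcomp Require Import all_classical all_reals all_analysis.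
From mathcomp Require Import measurable_realfun.
From mathcomp Require Import ring lra.

(** Since the derivatives of order [p + 1] of [V] vanish, [V] equals its Taylor
    polynomial, so that [V(x + a + S z)], with [a = h b], [S = sigma] and [z] the
    Brownian increment, is a finite sum of contractions of [V^(s)(x)].  The law
    of [z] is symmetric, so [V(x + a + S z)] may be averaged with
    [V(x + a - S z)].  After this the terms of order at most two give
    [V + h L V] up to [O(h (1 + V))].  For [h = r^4] the taming bounds
    read [|a| <= r^2 A] and [|S z| <= r A N], with [A = mu (1 + V)^gamma] and [N]
    the normalized increment, which has moments of all orders independent of
    [h]: a term of order three has lost its odd monomials in [z] and contains a
    factor [a], and a term of order at least four is small by itself, so that
    both are bounded by [r^4 |V^(s)| A^s <= c mu^s h (1 + V)] times a moment.
    Conditionally on the past this gives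
    [E(1 + V(X_(k+1))) <= (1 + h (rho + C)) E(1 + V(X_k))], which is iterated. *)

Set Implicit Arguments.
Unset Strict Implicit.
Unset Printing Implicit Defensive.

Import Order.TTheory GRing.Theory Num.Theory.
Import numFieldNormedType.Exports.

Local Open Scope classical_set_scope.
Local Open Scope ring_scope.

(** * Directional derivatives: linearity in the direction and a mean value theorem *)

Section directional_derivatives.
Context {R : realType} {U : normedModType R}.
Implicit Types (f : U -> R) (x y u v : U).

(** The denominator of the difference quotient is cleared, so that increments along several
    directions can be added and rescaled by plain inequalities. *)
Lemma is_derive_epsP f x v (l : R) : is_derive x v f l <->
  forall e, 0 < e -> exists2 r, 0 < r & forall t, 0 < `|t| < r ->
    `|f (t *: v + x) - f x - t * l| <= e * `|t|.
Proof.
have quotE (t : R) : t != 0 ->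
    `|l - t^-1 *: (f (t *: v + x) - f x)|
    = `|t|^-1 * `|f (t *: v + x) - f x - t * l|.
  move=> t0; rewrite -normfV -normrM distrC; congr (`|_|).
  by rewrite mulrBr mulKf.
split=> [[df dl] e e0|fl].
  have /cvgrPdist_le /(_ e e0) := df.
  rewrite near_withinE => -[r /= r0 hr]; exists r => // t /andP[t0 tr].
  rewrite normr_gt0 in t0.
  have := hr t; rewrite /= sub0r normrN => /(_ tr t0).
  rewrite -/(derive f x v) dl quotE //.
  by rewrite ler_pdivrMl ?normr_gt0 // [_ * e]mulrC.
have cvgl : t^-1 *: (f (t *: v + x) - f x) @[t --> 0^'] --> l.
  apply/cvgrPdist_le => e e0; have [r r0 hr] := fl e e0.
  rewrite near_withinE; exists r => //= t /=; rewrite distrC subr0 => tr t0.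
  rewrite quotE // ler_pdivrMl ?normr_gt0 // [_ * e]mulrC.
  by apply: hr; rewrite normr_gt0 t0.
apply: DeriveDef; last by apply: cvg_lim.
by apply/cvg_ex; exists l.
Qed.

End directional_derivatives.

Section directional_calculus.
Context {R : realType} {U : normedModType R}.
Implicit Types (f : U -> R) (x y u v : U).

Lemma is_derive_line f x v (l : R) t :
  is_derive (t *: v + x) v f l -> is_derive t 1 (fun s : R => f (s *: v + x)) l.
Proof.
move=> /is_derive_epsP fl; apply/is_derive_epsP => e /fl[r r0 hr].
exists r => // s /hr; congr (is_true (`|f _ - _ - _| <= _)).
by rewrite addrA -scalerDl /GRing.scale /= mulr1.
Qed.

Lemma MVT_line f y v (t : R) : (forall x, derivable f x v) ->
  exists2 c, `|c| <= `|t| & f (t *: v + y) - f y = t * 'D_v f (c *: v + y).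
Proof.
move=> df.
have dg (s : R) : is_derive s 1 (fun s : R => f (s *: v + y))
                     ('D_v f (s *: v + y)).
  exact/is_derive_line/derivableP.
have cg : continuous (fun s : R => f (s *: v + y)).
  move=> s; apply/differentiable_continuous/derivable1_diffP.
  by have [] := dg s.
have [t0|t0] := leP 0 t.
- have [|c /[!in_itv]/= /andP[c0 ct]] :=
    MVT_segment t0 (fun s _ => dg s); first exact: continuous_subspaceT.
  rewrite scale0r add0r subr0 mulrC => E; exists c => //.
  by rewrite !ger0_norm.
- have [|c /[!in_itv]/= /andP[c0 ct]] :=
    MVT_segment (ltW t0) (fun s _ => dg s); first exact: continuous_subspaceT.
  rewrite scale0r add0r sub0r => E; exists c.
    by rewrite !ler0_norm ?lerN2 // ltW.
  by rewrite -opprB E mulrN opprK mulrC.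
Qed.

(** Move by [t *: u] first, then by [t *: v]. The derivative at [x] controls the first increment;
    the mean value theorem turns the second into a value of ['D_v f] near [x], which continuity
    compares with ['D_v f x]. *)
Lemma is_derive_dirD f u v : (forall x, derivable f x u) ->
  (forall x, derivable f x v) -> continuous ('D_v f) ->
  forall x, is_derive x (u + v) f ('D_u f x + 'D_v f x).
Proof.
move=> du dv cv x; apply/is_derive_epsP => e e0.
have e2 : 0 < e / 2 by rewrite divr_gt0.
have /is_derive_epsP /(_ _ e2) [r1 r10 h1] := derivableP (du x).
have /cvgrPdist_lt /(_ _ e2) /nbhs_ballP [r2 /= r20 h2] := cv x.
have K0 : 0 < `|u| + `|v| + 1 by rewrite ltr_wpDl // addr_ge0.
(* The intermediate point is within [|t| * (|u| + |v|)] of [x]; the added 1 makes the divisor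
   positive. *)
exists (Num.min r1 (r2 / (`|u| + `|v| + 1))).
  by rewrite lt_min r10 divr_gt0.
move=> t /andP[t0]; rewrite lt_min => /andP[tr1 tr2].
have [c ct E] := MVT_line (t *: u + x) t dv.
rewrite scalerDr.
have -> : t *: u + t *: v + x = t *: v + (t *: u + x) by rewrite addrA [t *: v + _]addrC.
set A := f (t *: u + x) in E *.
have -> : f (t *: v + (t *: u + x)) - f x - t * ('D_u f x + 'D_v f x)
  = (A - f x - t * 'D_u f x) + (f (t *: v + (t *: u + x)) - A - t * 'D_v f x).
  by ring.
apply: (le_trans (ler_normD _ _)).
have -> : e * `|t| = e / 2 * `|t| + e / 2 * `|t| by field.
apply: lerD; first by apply: h1; rewrite t0.
rewrite E -mulrBr normrM mulrC ler_wpM2r // ltW // distrC.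
apply: h2; rewrite -ball_normE /=.
rewrite [_ + (_ + x)]addrA opprD addrCA subrr addr0 normrN.
apply: (le_lt_trans (ler_normD _ _)); rewrite !normrZ.
apply: (@le_lt_trans _ _ (`|t| * (`|u| + `|v| + 1))).
  by rewrite !mulrDr mulr1 [X in _ <= X + _]addrC ler_wpDr // lerD // ler_wpM2r.
by rewrite -ltr_pdivlMr.
Qed.

Lemma is_derive_dirZ f (k : R) v x (l : R) :
  is_derive x v f l -> is_derive x (k *: v) f (k * l).
Proof.
move=> /is_derive_epsP fl; apply/is_derive_epsP => e e0.
have [->|k0] := eqVneq k 0.
  exists 1 => // t _.
  by rewrite scale0r scaler0 add0r subrr mul0r mulr0 subrr normr0 mulr_ge0 // ltW.
have [r r0 hr] := fl (e / `|k|) (divr_gt0 e0 (eqbRL (normr_gt0 _) k0)).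
exists (r / `|k|); first by rewrite divr_gt0 // normr_gt0.
move=> t /andP[t0]; rewrite ltr_pdivlMr ?normr_gt0 // -normrM => tr.
have := hr (t * k); rewrite tr normr_gt0 mulf_neq0 //= -?normr_gt0 // => /(_ isT).
rewrite scalerA mulrA => /le_trans; apply.
rewrite normrM (_ : e / `|k| * (`|t| * `|k|) = e * `|t|) //.
by field; rewrite normr_eq0.
Qed.

(** One direction [y i *: e i] is added at a time. It is placed second in [is_derive_dirD], where
    continuity of the derivative is asked for. *)
Lemma is_derive_dir_sum (I : Type) (r : seq I) (e : I -> U) (y : I -> R) f :
  (forall i x, derivable f x (e i)) -> (forall i, continuous ('D_(e i) f)) ->
  forall x, is_derive x (\sum_(i <- r) y i *: e i) f
              (\sum_(i <- r) y i * 'D_(e i) f x).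
Proof.
move=> df cf; elim: r => [|i r IH] x.
  rewrite !big_nil; apply/is_derive_epsP => a a0; exists 1 => // t _.
  by rewrite scaler0 add0r subrr mulr0 subrr normr0 mulr_ge0 // ltW.
have dZ z : is_derive z (y i *: e i) f (y i * 'D_(e i) f z).
  exact/is_derive_dirZ/derivableP.
rewrite !big_cons addrC [X in is_derive _ _ _ X]addrC.
have E z : 'D_(y i *: e i) f z = y i * 'D_(e i) f z by apply: derive_val.
have E' z : 'D_(\sum_(i <- r) y i *: e i) f z = \sum_(i <- r) y i * 'D_(e i) f z.
  exact: derive_val.
rewrite -E -E'; apply: is_derive_dirD => z; [by have [] := IH z|by have [] := dZ z|].
rewrite (_ : 'D_(y i *: e i) f = (fun z => y i * 'D_(e i) f z)); last exact/funext.
by apply: cvgM; [exact: cvg_cst|exact: cf].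
Qed.

End directional_calculus.

(** The induction hypothesis, applied to the shifted chain, expands [g 1]; the polynomial [P] then
    has the same derivative and the same value at 0 as [g 0]. There is no remainder because the
    chain ends in 0. *)
Lemma taylor_derive_chain (R : realType) (n : nat) (g : nat -> R -> R) :
  (forall s (t : R), (s <= n)%N -> is_derive t 1 (g s) (g s.+1 t)) ->
  (forall t, g n.+1 t = 0) ->
  forall t, g 0%N t = \sum_(s < n.+1) g s 0 * t ^+ s / s`!%:R.
Proof.
elim: n g => [|n IH] g dg g0 t.
  rewrite big_ord1 expr0 fact0 mulr1 invr1 mulr1.
  by apply: is_derive_0_is_cst => s; rewrite -(g0 s); exact: dg.
have {}IH := IH (fun s => g s.+1) (fun s t le => dg s.+1 t le) g0.
pose P t := \sum_(s < n.+2) g s 0 * t ^+ s / s`!%:R.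
suff dP (s : R) : is_derive s 1 P (g 1%N s).
  have : (g 0%N - P) t = (g 0%N - P) 0.
    apply: is_derive_0_is_cst => s; rewrite -(subrr (g 1%N s)).
    by apply: is_deriveB; exact: dg.
  rewrite !fctE /P [in X in _ = X]big_ord_recl /= expr0 fact0 mulr1 invr1 mulr1.
  rewrite [X in _ - (_ + X)]big1 => [|i _]; last by rewrite expr0n /= mulr0 mul0r.
  by rewrite addr0 subrr => /eqP; rewrite subr_eq0 => /eqP.
rewrite IH.
have -> : P = \sum_(s < n.+2) (fun t => g s 0 * t ^+ s / s`!%:R).
  by apply/funext => u; rewrite /P fct_sumE.
(* The sum is reindexed like [P]; at [i = 0] the factor [*+ i] vanishes, which makes the truncated
   [i.-1] harmless. *)
have -> : \sum_(i < n.+1) g i.+1 0 * s ^+ i / i`!%:R =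
   \sum_(i < n.+2) (g i 0 / i`!%:R * (s ^+ i.-1 *+ i)).
  rewrite [RHS]big_ord_recl /= mulr0n mulr0 add0r; apply: eq_bigr => i _.
  rewrite /bump /= add1n factS natrM -mulr_natr.
  have h1 : i.+1%:R != 0 :> R by rewrite pnatr_eq0.
  have h2 : i`!%:R != 0 :> R by rewrite pnatr_eq0 -lt0n fact_gt0.
  by field; rewrite h2 nat1r h1.
apply: is_derive_sum => i.
have -> : (fun t0 : R => g i 0 * t0 ^+ i / i`!%:R) =
   ((g i 0 / i`!%:R) *: ((fun x : R => x) ^+ i) : R -> R).
  apply/funext => u; rewrite /GRing.scale /=.
  by rewrite fctE /GRing.scale /= mulrAC.
apply: is_deriveZ.
have := @is_deriveX R R id i s 1 1 (is_derive_id _ _).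
by rewrite /GRing.scale /= mulr1 mulr_natl.
Qed.

(** * Exact Taylor expansion of [V] by contractions of its derivative tensors *)

Section taylor_class_C.
Context {R : realType} {d : nat}.
Implicit Types (V : 'cV[R]_d -> R) (x y : 'cV[R]_d) (l : seq 'I_d).

(* The contraction of the tensor [V^(size l + s)(x)] with [y] in [s] of its
   arguments, the others being the basis vectors listed in [l]. *)
Fixpoint contract V x y (s : nat) l : R :=
  if s is s'.+1 then \sum_(i < d) y i 0 * contract V x y s' (i :: l)
  else iter_partial V l x.

(** The direction [y] is decomposed in the standard basis; the partial derivatives of the next order
    are continuous, so [is_derive_dir_sum] applies. *)
Lemma is_derive_iter_partial n V l x y : class_C n V -> (size l < n)%N ->
  is_derive x y (iter_partial V l)
    (\sum_(i < d) y i 0 * iter_partial V (i :: l) x).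
Proof.
move=> VC ln; pose z := \sum_(i < d) y i 0 *: delta_mx i 0 : 'cV[R]_d.
have zE i : z i 0 = y i 0.
  rewrite summxE (bigD1 i) //= big1 => [|j ji]; rewrite !mxE ?eqxx ?mulr1 ?addr0 //.
  by rewrite eq_sym (negPf ji) mulr0.
have -> : y = z by apply/colP => i; rewrite zE.
under eq_bigr do rewrite zE.
apply: is_derive_dir_sum => i.
  by have [_] := VC l (ltnW ln); exact.
by have [+ _] := VC (i :: l) ln.
Qed.

Lemma is_derive_contract n V x y s l (t : R) : class_C n V ->
  (size l + s < n)%N ->
  is_derive t 1 (fun t => contract V (t *: y + x) y s l)
    (contract V (t *: y + x) y s.+1 l).
Proof.
move=> VC; elim: s l => [|s IH] l ln.
  apply: is_derive_line; rewrite addn0 in ln.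
  exact: is_derive_iter_partial VC ln.
rewrite (_ : (fun _ => _) =
  \sum_(i < d) (y i 0 *: (fun t => contract V (t *: y + x) y s (i :: l))) ); last first.
  by apply/funext => u; rewrite fct_sumE.
apply: is_derive_sum => i; apply: is_deriveZ.
by apply: IH; rewrite /= addSnnS.
Qed.

(** The contraction has [d ^ s] monomials, each at most [B ^ s] times an entry of the tensor of
    order [size l + s]. *)
Lemma contract_bound V x y s l (c B : R) : 0 <= B ->
  (forall i, `|y i 0| <= B) ->
  (forall l', size l' = (size l + s)%N -> `|iter_partial V l' x| <= c) ->
  `|contract V x y s l| <= c * (d%:R * B) ^+ s.
Proof.
move=> B0 yB; elim: s l => [|s IH] l hc /=.
  by rewrite expr0 mulr1; apply: hc; rewrite addn0.
apply: (le_trans (ler_norm_sum _ _ _)).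
apply: (@le_trans _ _ (\sum_(i < d) B * (c * (d%:R * B) ^+ s))).
  apply: ler_sum => i _; rewrite normrM; apply: ler_pM => //.
  by apply: IH => l' /= E; apply: hc; rewrite E addSnnS.
rewrite sumr_const card_ord -mulr_natl exprS le_eqVlt; apply/orP; left.
by apply/eqP; ring.
Qed.

(** Along the line [t *: y + x] the contractions with [y] form a chain of derivatives that ends in 0
    at order [p.+1]; the expansion is taken at [t = 1]. *)
Lemma taylor_contract (p : nat) V x y : class_C p.+1 V ->
  (forall x (i : p.+1.-tuple 'I_d), iter_partial V i x = 0) ->
  V (x + y) = \sum_(s < p.+1) contract V x y s [::] / s`!%:R.
Proof.
move=> VC V0.
have contract0 z s l : (s + size l)%N = p.+1 -> contract V z y s l = 0.
  elim: s l => [|s IH] l /= E; last first.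
    rewrite big1 // => i _; rewrite IH ?mulr0 //= -E addnS //.
  have szl : size l == p.+1 by rewrite -E.
  exact: (V0 z (Tuple szl)).
have dC (s : nat) (t : R) : (s <= p)%N ->
    is_derive t 1 (fun t => contract V (t *: y + x) y s [::])
      (contract V (t *: y + x) y s.+1 [::]).
  by move=> sp; apply: is_derive_contract VC _.
have C0 (t : R) : contract V (t *: y + x) y p.+1 [::] = 0.
  by apply: contract0; rewrite addn0.
have := @taylor_derive_chain R p (fun s t => contract V (t *: y + x) y s [::]) dC C0 1.
rewrite scale1r addrC /= => ->; apply: eq_bigr => s _.
by rewrite scale0r add0r expr1n mulr1.
Qed.

Lemma iter_partial_le_tensor V l x :
  `|iter_partial V l x| <= tensor_hsnorm V (size l) x.
Proof.
rewrite /tensor_hsnorm -sqrtr_sqr ler_wsqrtr // (bigD1 (in_tuple l)) //=.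
by rewrite lerDl sumr_ge0 // => i _; exact: sqr_ge0.
Qed.

End taylor_class_C.

(** * Bound on the Taylor expansion averaged over the sign of the noise *)

Section symmetrized_taylor.
Context {R : realType} {d : nat}.
Variables (p : nat) (gamma mu c : R) (V : 'cV[R]_d -> R).
Hypotheses (V_class : class_C p.+1 V)
  (V_poly : forall x (i : p.+1.-tuple 'I_d), iter_partial V i x = 0)
  (V_ge0 : forall x, 0 <= V x) (c_ge0 : 0 <= c) (mu_ge0 : 0 <= mu)
  (V_growth : forall (x : 'cV[R]_d) (s : nat), (s <= p)%N ->
     tensor_hsnorm V s x <= c * (1 + V x) `^ (1 - s%:R * gamma)).

Lemma iter_partial_bound x l : (size l <= p)%N ->
  `|iter_partial V l x| <= c * (1 + V x) `^ (1 - (size l)%:R * gamma).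
Proof.
by move=> sl; apply: (le_trans (iter_partial_le_tensor _ _ _)); exact: V_growth.
Qed.

Let A x := mu * (1 + V x) `^ gamma.

Let V1 x : 0 < 1 + V x. Proof. by rewrite ltr_pwDl. Qed.

(** The exponents [1 - s * gamma] and [s * gamma] add up to 1: at every order the growth of the
    derivatives and the taming bound combine to exactly [1 + V x]. *)
Lemma growth_powM x (s : nat) :
  c * (1 + V x) `^ (1 - s%:R * gamma) * A x ^+ s = (1 + V x) * (c * mu ^+ s).
Proof.
rewrite /A exprMn -(powR_mulrn _ (powR_ge0 _ _)) -powRrM.
rewrite [gamma * _]mulrC.
have -> : c * (1 + V x) `^ (1 - s%:R * gamma) * (mu ^+ s * (1 + V x) `^ (s%:R * gamma)) =
  (1 + V x) `^ (1 - s%:R * gamma) * (1 + V x) `^ (s%:R * gamma) * (c * mu ^+ s) by ring.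
rewrite -powRD; last by apply/implyP => _; rewrite gt_eqF.
by rewrite subrK powRr1 // ltW.
Qed.

Variables (x a z : 'cV[R]_d) (r N : R).
Hypotheses (r_ge0 : 0 <= r) (r_le1 : r <= 1) (N_ge0 : 0 <= N).
Hypothesis a_le : forall i, `|a i 0| <= r ^+ 2 * A x.
Hypothesis z_le : forall i, `|z i 0| <= r * A x * N.

Let sym s :=
  (contract V x (a + z) s [::] + contract V x (a - z) s [::]) / 2.

(** Error allowed at order [s]. Apart from the factor [r ^+ 4], which becomes the step size, it does
    not involve [r]. *)
Let rest s := r ^+ 4 * (1 + V x) * (c * (d%:R * mu * (1 + N)) ^+ s).

Let A_ge0 : 0 <= A x. Proof. by rewrite mulr_ge0 ?powR_ge0. Qed.

Let restE s : rest s = r ^+ 4 *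
  (c * (1 + V x) `^ (1 - s%:R * gamma) * A x ^+ s) * (d%:R * (1 + N)) ^+ s.
Proof. by rewrite growth_powM /rest !exprMn; ring. Qed.

Let sym1 : sym 1 = \sum_(i < d) a i 0 * iter_partial V [:: i] x.
Proof.
rewrite /sym /= -big_split mulr_suml; apply: eq_bigr => i _ /=.
by rewrite !mxE; field.
Qed.

(** The cross terms between [a] and [z] cancel. The part quadratic in [z] will average to the trace
    term of the generator. *)
Let sym2 : sym 2 =
  (\sum_(i < d) \sum_(j < d) z i 0 * z j 0 * iter_partial V [:: j; i] x)
  + contract V x a 2 [::].
Proof.
rewrite /sym /= -!big_split mulr_suml; apply: eq_bigr => i _ /=.
rewrite !mulr_sumr -!big_split mulr_suml; apply: eq_bigr => j _ /=.
by rewrite !mxE; field.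
Qed.

(** Each factor [a] is of order [r ^+ 2], so two of them already give [r ^+ 4]. *)
Let quad_le : (2 <= p)%N -> `|contract V x a 2 [::]| <= rest 2.
Proof.
move=> p2; have /(_ (c * (1 + V x) `^ (1 - 2%:R * gamma))) := @contract_bound R d V x a 2 [::] _ (r ^+ 2 * A x).
have B0 : 0 <= r ^+ 2 * A x by rewrite mulr_ge0 // exprn_ge0.
move=> /(_ B0 a_le) /(_ _) /le_trans; apply.
  by move=> l' E; have := @iter_partial_bound x l'; rewrite E; apply.
rewrite restE.
set K := c * _ `^ _; have K0 : 0 <= K by rewrite mulr_ge0 // powR_ge0.
rewrite (_ : K * (d%:R * (r ^+ 2 * A x)) ^+ 2 = r ^+ 4 * (K * A x ^+ 2) * (d%:R * 1) ^+ 2); last by ring.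
apply: ler_wpM2l; first by rewrite !(exprn_ge0, mulr_ge0, powR_ge0).
have d1 : 0 <= d%:R * 1 :> R by rewrite mulr_ge0.
have d2 : d%:R * 1 <= d%:R * (1 + N) by rewrite ler_wpM2l // lerDl.
by apply: lerXn2r => //; rewrite nnegrE // (le_trans d1).
Qed.

(* The terms of odd degree in [z] cancel, so every remaining monomial of
   degree three contains a factor [a], hence is of order [r ^+ 4]. *)
Let cube_le : (3 <= p)%N -> `|sym 3| <= rest 3.
Proof.
move=> p3; pose K := c * (1 + V x) `^ (1 - 3%:R * gamma).
have K0 : 0 <= K by rewrite mulr_ge0 // powR_ge0.
pose t i j k := a i 0 * a j 0 * a k 0 + a i 0 * z j 0 * z k 0
  + z i 0 * a j 0 * z k 0 + z i 0 * z j 0 * a k 0.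
have symE : sym 3 = \sum_(i < d) \sum_(j < d) \sum_(k < d)
   t i j k * iter_partial V [:: k; j; i] x.
  rewrite /sym /= -!big_split mulr_suml; apply: eq_bigr => i _ /=.
  rewrite !mulr_sumr -!big_split mulr_suml; apply: eq_bigr => j _ /=.
  rewrite !mulrA !mulr_sumr -!big_split mulr_suml; apply: eq_bigr => k _ /=.
  by rewrite /t !mxE; field.
pose a' := r ^+ 2 * A x; pose z' := r * A x * N.
have a0 : 0 <= a' by rewrite mulr_ge0 // exprn_ge0.
have z0 : 0 <= z' by rewrite !mulr_ge0 // powR_ge0.
have tle i j k : `|t i j k| <= r ^+ 4 * A x ^+ 3 * (1 + N) ^+ 3.
  apply: (@le_trans _ _ (a' * a' * a' + a' * z' * z' + z' * a' * z' + z' * z' * a')).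
    have le3 u v w u' v' w' : `|u| <= u' -> `|v| <= v' -> `|w| <= w' ->
        `|u * v * w| <= u' * v' * w' :> R.
      by move=> *; rewrite !normrM; apply: ler_pM => //; apply: ler_pM.
    apply: (le_trans (ler_normD _ _)); apply: lerD; last exact: le3.
    apply: (le_trans (ler_normD _ _)); apply: lerD; last exact: le3.
    by apply: (le_trans (ler_normD _ _)); apply: lerD; exact: le3.
  (* Since [r ^+ 2 <= 1], the last factor is dominated by the expansion of [(1 + N) ^+ 3]. *)
  rewrite (_ : _ + _ = r ^+ 4 * A x ^+ 3 * (r ^+ 2 + 3 * N ^+ 2)); last by rewrite /a' /z'; ring.
  apply: ler_wpM2l; first by rewrite mulr_ge0 ?exprn_ge0.
  have : r ^+ 2 <= 1 by rewrite exprn_ile1.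
  have : 0 <= N ^+ 3 by rewrite exprn_ge0.
  rewrite (_ : (1 + N) ^+ 3 = 1 + 3 * N + 3 * N ^+ 2 + N ^+ 3); last by ring.
  by move: N_ge0; lra.
rewrite symE (_ : rest 3 = \sum_(i < d) \sum_(j < d) \sum_(k < d)
   (r ^+ 4 * A x ^+ 3 * (1 + N) ^+ 3) * K); last first.
  by rewrite !sumr_const !card_ord -!mulrnA -mulr_natl !natrM restE -/K; ring.
do 3! (apply: (le_trans (ler_norm_sum _ _ _)); apply: ler_sum => ? _).
rewrite normrM ler_pM //.
exact: (@iter_partial_bound x [:: _; _; _]).
Qed.

(** For [r <= 1] the entries of both [a + z] and [a - z] are at most [r * A x * (1 + N)], so order
    [s] carries [r ^+ s <= r ^+ 4]. *)
Let high_le s : (4 <= s)%N -> (s <= p)%N -> `|sym s| <= rest s.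
Proof.
move=> s4 sp; pose K := c * (1 + V x) `^ (1 - s%:R * gamma).
have K0 : 0 <= K by rewrite mulr_ge0 // powR_ge0.
pose B := r * A x * (1 + N).
have B0 : 0 <= B by rewrite !(mulr_ge0, powR_ge0, addr_ge0).
have bound e : `|e| = 1 -> `|contract V x (a + e *: z) s [::]| <= K * (d%:R * B) ^+ s.
  move=> e1; apply: contract_bound => //.
    move=> i; rewrite !mxE (le_trans (ler_normD _ _)) // normrM e1 mul1r.
    rewrite /B mulrDr mulr1; apply: lerD => //.
    apply: (le_trans (a_le i)); apply: ler_wpM2r => //.
    by rewrite expr2 ler_piMl.
  by move=> l' E; have := @iter_partial_bound x l'; rewrite E; apply.
have := bound 1 (normr1 _); have := bound (-1) (normrN1 _).
rewrite scale1r scaleN1r => b1 b2.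
apply: (@le_trans _ _ (K * (d%:R * B) ^+ s)).
  rewrite /sym normrM [ `|2^-1|]ger0_norm ?invr_ge0 //.
  by rewrite ler_pdivrMr // mulr_natr mulr2n (le_trans (ler_normD _ _)) // lerD.
rewrite restE -/K (_ : K * _ = r ^+ s * (K * A x ^+ s * (d%:R * (1 + N)) ^+ s)); last first.
  by rewrite /B !exprMn; ring.
rewrite -[X in _ <= X]mulrA; apply: ler_wpM2r.
  by rewrite !(exprn_ge0, mulr_ge0, powR_ge0, addr_ge0).
exact: ler_wiXn2l.
Qed.

Lemma taylor_sym_bound : (2 <= p)%N ->
  2^-1 * (V (x + (a + z)) + V (x + (a - z))) <=
  V x + \sum_(i < d) a i 0 * iter_partial V [:: i] x
  + 2^-1 * (\sum_(i < d) \sum_(j < d)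
             z i 0 * z j 0 * iter_partial V [:: j; i] x)
  + r ^+ 4 * (1 + V x) *
    (\sum_(s < p.+1) c * (d%:R * mu * (1 + N)) ^+ s).
Proof.
move=> p2.
rewrite !(taylor_contract _ _ V_class V_poly) -big_split mulr_sumr /=.
have fact_le (s : nat) (u w : R) : `|u| <= w -> u / s`!%:R <= w.
  move=> uw; rewrite ler_pdivrMr ?ltr0n ?fact_gt0 //.
  apply: (le_trans (ler_norm _)); apply: (le_trans uw).
  by rewrite ler_peMr ?(le_trans _ uw) // ler1n fact_gt0.
(* The part of each order that is kept exactly; what is left at order [s] is at most [rest s], so
   the two sums are compared term by term. *)
pose main (s : nat) := match s with
  | 0%N => V x
  | 1%N => \sum_(i < d) a i 0 * iter_partial V [:: i] x
  | 2%N => 2^-1 * (\sum_(i < d) \sum_(j < d)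
             z i 0 * z j 0 * iter_partial V [:: j; i] x)
  | _ => 0
  end.
have mainE : \sum_(s < p.+1) main s = main 0%N + main 1%N + main 2%N.
  case: p p2 => [|[|q]] // _; rewrite !big_ord_recl.
  by rewrite [X in _ + (_ + (_ + X))]big1 // addr0 !addrA.
rewrite -/(main 0%N) -/(main 1%N) -/(main 2%N) -mainE mulr_sumr -big_split /=.
apply: ler_sum => -[s /= sp] _.
rewrite ltnS in sp.
have -> : 2^-1 * (contract V x (a + z) s [::] / s`!%:R + contract V x (a - z) s [::] / s`!%:R) =
   sym s / s`!%:R by rewrite /sym -mulrDl [RHS]mulrAC [RHS]mulrC.
have rest_ge0 : 0 <= rest s.
  by rewrite !(exprn_ge0, mulr_ge0, powR_ge0, addr_ge0).
rewrite -/(rest s).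
case: s sp rest_ge0 => [|[|[|[|s]]]] sp rest_ge0.
- rewrite /sym /= fact0 invr1 mulr1 (_ : (V x + V x) / 2 = V x); last by field.
  by rewrite lerDl.
- by rewrite sym1 invr1 mulr1 lerDl.
- rewrite sym2 mulrDl mulrC lerD //; exact/fact_le/quad_le.
- by rewrite add0r; exact/fact_le/cube_le.
- by rewrite add0r; exact/fact_le/high_le.
Qed.

End symmetrized_taylor.

(** * The Borel sigma-algebra of matrices and its generation by boxes *)

Section borel_matrices.
Context {R : realType} {m n : nat}.

Definition box (B : 'I_m -> 'I_n -> set R) : set 'M[R]_(m, n) :=
  [set x | forall i j, B i j (x i j)].

(** A pi-system that suits the Wiener process, whose increments have their law prescribed on
    boxes. *)
Definition boxes : set (set 'M[R]_(m, n)) :=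
  [set box B | B in [set B | forall i j, measurable (B i j)]].

Lemma measurable_coord i j :
  measurable_fun setT (fun x : borelMx R m n => (x : 'M[R]_(m, n)) i j).
Proof.
apply: (measurability _ (RGenOpens.measurableE R)).
move=> _ [_ [a [b ->]] <-]; rewrite setTI.
apply: sub_sigma_algebra.
by apply: open_comp => [x _|]; [exact: coord_continuous|exact: interval_open].
Qed.

Lemma measurable_borelMx_fun (f : 'M[R]_(m, n) -> R) : continuous f ->
  measurable_fun setT (f : borelMx R m n -> R).
Proof.
move=> cf; apply: (measurability _ (RGenOpens.measurableE R)).
move=> _ [_ [a [b ->]] <-]; rewrite setTI.
apply: sub_sigma_algebra.
by apply: open_comp => [x _|]; [exact: cf|exact: interval_open].
Qed.

Lemma measurable_box B : (forall i j, measurable (B i j)) ->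
  measurable (box B : set (borelMx R m n)).
Proof.
move=> mB; rewrite (_ : box B = \bigcap_(k in [set: 'I_m * 'I_n])
    ((fun x : 'M[R]_(m, n) => x k.1 k.2) @^-1` B k.1 k.2)); last first.
  by apply/seteqP; split=> x xB; [move=> k _; exact: xB|move=> i j; exact: (xB (i, j))].
apply: fin_bigcap_measurable => [|k _]; first exact: finite_finset.
by rewrite -[X in measurable X]setTI; exact: measurable_coord.
Qed.

Lemma boxes_setI : setI_closed boxes.
Proof.
move=> _ _ [B mB <-] [C mC <-]; exists (fun i j => B i j `&` C i j).
  by move=> i j; exact: measurableI.
apply/seteqP; split=> x; first by move=> BC; split=> i j; have [] := BC i j.
by move=> [xB xC] i j.
Qed.

(** An open set is the union of the cubes contained in it that have a rational centre and radius
    [1 / n.+1], and these are countably many. *)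
Lemma open_boxes (U : set 'M[R]_(m, n)) : open U -> <<s boxes >> U.
Proof.
move=> oU.
pose q (k : 'M[rat]_(m, n) * nat) : set 'M[R]_(m, n) :=
  box (fun i j => ball (ratr (k.1 i j) : R) k.2.+1%:R^-1).
pose F k := [set x | q k x /\ q k `<=` U].
have -> : U = \bigcup_(k in setT) F k.
  apply/seteqP; split=> [x Ux|x [k _ [qx]]]; last exact.
  have /nbhs_ballP [e /= e0 eU] := oU _ Ux.
  (* Half of [e], since the centre is within one radius of [x] and the cube extends one more
     radius. *)
  have [N hN] : exists N : nat, N.+1%:R^-1 < e / 2.
    have e2 : 0 < e / 2 by rewrite divr_gt0.
    have [N _ hN] := near_infty_natSinv_lt (PosNum e2).
    by exists N; apply: (hN N) => /=.
  have r0 : 0 < N.+1%:R^-1 :> R by rewrite invr_gt0.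
  have hq i j : exists c : rat, ball (x i j) N.+1%:R^-1 (ratr c : R).
    have /rat_in_itvoo[c] : x i j - N.+1%:R^-1 < x i j + N.+1%:R^-1 by rewrite ltrBlDr -addrA ltrDl addr_gt0.
    rewrite in_itv /= => /andP[c1 c2]; exists c.
    by rewrite /ball /= ltr_distlC c1 c2.
  pose Q := \matrix_(i, j) (sval (cid (hq i j))) : 'M[rat]_(m, n).
  have hQ i j : ball (x i j) N.+1%:R^-1 (ratr (Q i j) : R).
    by rewrite mxE; case: cid.
  exists (Q, N) => //; split; first by move=> i j /=; exact/ball_sym.
  move=> y qy; apply: eU; split=> // i j.
  have := ball_triangle (hQ i j) (qy i j).
  by apply: le_ball; rewrite (splitr e) lerD // ltW.
apply: (@countable_bigcupT_measurable _ (g_sigma_algebraType boxes)).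
  exact: countableP.
move=> k; have [kU|kU] := pselect (q k `<=` U); last first.
  rewrite (_ : F k = set0); first exact: measurable0.
  by apply/seteqP; split=> // x [].
rewrite (_ : F k = q k); last by apply/seteqP; split=> [x []|x].
apply: sub_sigma_algebra; exists (fun i j => ball (ratr (k.1 i j) : R) k.2.+1%:R^-1) => //.
by move=> i j; exact: measurable_ball.
Qed.

Lemma measurable_borelMxE : @measurable _ (borelMx R m n) = <<s boxes >>.
Proof.
apply/seteqP; split.
  apply: smallest_sub; first exact: smallest_sigma_algebra.
  exact: open_boxes.
apply: smallest_sub; first exact: smallest_sigma_algebra.
by move=> _ [B mB <-]; exact: measurable_box.
Qed.

Lemma measurable_fun_borelMx d (T : measurableType d) (D : set T)
    (f : T -> 'M[R]_(m, n)) : measurable D ->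
  (forall i j, measurable_fun D (fun t => f t i j)) ->
  measurable_fun D (f : T -> borelMx R m n).
Proof.
move=> mD mf; apply: (measurability _ measurable_borelMxE).
move=> _ [_ [B mB <-] <-].
rewrite (_ : _ `&` _ = \bigcap_(k in [set: 'I_m * 'I_n]) (D `&` (fun t => f t k.1 k.2) @^-1` B k.1 k.2) `&` D); last first.
  apply/seteqP; split=> [x [Dx xB]|x [xB Dx]].
    by split=> // k _; split=> //; exact: xB.
  by split=> // i j; have [] := xB (i, j) I.
apply: measurableI => //; apply: fin_bigcap_measurable => [|k _].
  exact: finite_finset.
exact: mf.
Qed.

(** Uniqueness of finite measures on a generating pi-system; the whole space is itself a box. *)
Lemma eq_measure_boxes (m1 m2 : {measure set (borelMx R m n) -> \bar R}) :
  (m1 setT < +oo)%E ->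
  (forall B, (forall i j, measurable (B i j)) -> m1 (box B) = m2 (box B)) ->
  forall A, measurable A -> m1 A = m2 A.
Proof.
move=> m1oo m12 A mA.
apply: (@measure_unique _ R (borelMx R m n) boxes (fun=> setT)) => //.
- exact: measurable_borelMxE.
- exact: boxes_setI.
- by move=> _; exists (fun _ _ => setT) => //; apply/seteqP; split.
- by rewrite bigcup_const //; exists 0%N.
- by move=> _ [B mB <-]; exact: m12.
Qed.

End borel_matrices.

(** * Integration against a measure given by a density *)

Section integral_density.
Local Open Scope ereal_scope.
Context d (T : measurableType d) (R : realType).
Variables (mu nu : {measure set T -> \bar R}) (g : T -> R).
Hypotheses (mg : measurable_fun setT g) (g_ge0 : forall x, (0 <= g x)%R).
Hypothesis nuE : forall A, measurable A -> nu A = \int[mu]_(x in A) (g x)%:E.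

Import HBNNSimple.

(** For indicators this is [nuE]; it extends to simple functions by linearity and to [f] by monotone
    convergence. *)
Lemma ge0_integral_density (f : T -> \bar R) :
  measurable_fun setT f -> (forall x, 0 <= f x) ->
  \int[nu]_x f x = \int[mu]_x (f x * (g x)%:E).
Proof.
move=> mf f0.
pose f_ := nnsfun_approx measurableT mf.
have cvg_f x : (f_ n x)%:E @[n --> \oo] --> f x by apply: cvg_nnsfun_approx.
transitivity (limn (fun n => \int[nu]_x (f_ n x)%:E)).
  rewrite -monotone_convergence//.
  - by apply: eq_integral => y _; apply/esym/cvg_lim => //; exact: cvg_f.
  - by move=> n; exact/measurable_EFinP/measurable_funP.
  - by move=> n y _; rewrite lee_fin.
  - by move=> y _ m n mn; rewrite lee_fin; exact/lefP/nd_nnsfun_approx.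
rewrite [X in limn X](_ : _ = (fun n => \int[mu]_x ((f_ n x)%:E * (g x)%:E))).
  rewrite -monotone_convergence//.
  - apply: eq_integral => x _ /=; apply/cvg_lim => //.
    by apply: cvgeZr => //; exact: cvg_f.
  - move=> n; apply/measurable_EFinP/measurable_funM => //.
  - by move=> n x _; rewrite lee_fin mulr_ge0.
  - move=> x _ m n mn; rewrite lee_fin ler_wpM2r //.
    exact/lefP/nd_nnsfun_approx.
apply/funext => n.
have mfn r : measurable (f_ n @^-1` [set r]) by exact: measurable_sfunP.
transitivity (\sum_(k \in range (f_ n))
    \int[mu]_x ((k * \1_(f_ n @^-1` [set k]) x)%:E * (g x)%:E)).
  rewrite integralT_nnsfun sintegralE; apply: eq_fsbigr => r.
  rewrite inE => -[y _ yr].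
  have r0 : (0 <= r)%R by rewrite -yr.
  under eq_integral do rewrite EFinM -muleA.
  rewrite ge0_integralZl//; last first.
  - by move=> x _; rewrite -EFinM lee_fin mulr_ge0 // indicE.
  - by apply/measurable_EFinP/measurable_funM => //; exact: measurable_indic.
  congr (_ * _); rewrite nuE // [in LHS]integral_mkcond.
  by apply: eq_integral => x _; rewrite patchE indicE; case: ifPn => _; rewrite ?mul1e ?mul0e.
rewrite -ge0_integral_fsum//.
- apply: eq_integral => x _; rewrite [in RHS](fimfunE (f_ n)) -fsumEFin//.
  by rewrite -ge0_mule_fsuml// => r; rewrite nnfun_muleindic_ge0.
- move=> r; apply/measurable_EFinP/measurable_funM => //.
  by apply: measurable_funM => //; exact: measurable_indic.
- move=> r x _; apply: mule_ge0; last by rewrite lee_fin.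
  by rewrite EFinM nnfun_muleindic_ge0.
Qed.

End integral_density.

(** * Symmetry and moments of the centred normal law *)

Section normal_moments.
Context {R : realType}.
Variable s : R.
Hypothesis s_gt0 : 0 < s.
Local Notation leb := (@lebesgue_measure R).
Local Notation pdf := (normal_pdf 0 s).
Local Notation N := (normal_prob 0 s).

Let s_neq0 : s != 0. Proof. by rewrite gt_eqF. Qed.

Lemma integral_normal_prob (f : R -> \bar R) :
  measurable_fun setT f -> (forall x, 0 <= f x)%E ->
  (\int[N]_x f x = \int[leb]_x (f x * (pdf x)%:E))%E.
Proof.
move=> mf f0.
have := @ge0_integral_density _ _ R leb N pdf (measurable_normal_pdf 0 s) (normal_pdf_ge0 0 s).
move=> /(_ (fun A _ => erefl) f mf f0) -> //.
Qed.

Lemma normal_pdf0E x : pdf x = normal_peak s * expR (- x ^+ 2 / (s ^+ 2 *+ 2)).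
Proof. by rewrite normal_pdfE // /normal_fun subr0. Qed.

Lemma normal_pdf0N x : pdf (- x) = pdf x.
Proof. by rewrite !normal_pdf0E sqrrN. Qed.

(** The density is even and Lebesgue measure is invariant under reflection. *)
Lemma normal_prob_opp (A : set R) : measurable A -> N (-%R @^-1` A) = N A.
Proof.
move=> mA; rewrite /normal_prob.
transitivity (\int[pushforward leb (-%R : _ -> measurableTypeR R)]_(y in A) (pdf y)%:E)%E.
  rewrite ge0_integral_pushforward //.
  - by apply: eq_integral => x _; rewrite /= normal_pdf0N.
  - apply/measurable_EFinP/measurable_funTS; exact: measurable_normal_pdf.
  - by move=> y _; rewrite lee_fin normal_pdf_ge0.
apply: eq_measure_integral => //= B mB BA; exact: lebesgue_measureN.
Qed.

(** The constant is crude, but the scaling [s ^+ n] is exact: the moments of the normalized variable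
    are bounded independently of [s]. *)
Lemma normal_moment_le (n : nat) :
  (\int[N]_x (`|x| ^+ n)%:E <= (s ^+ n * ((3 * n)%:R ^+ n * 2))%:E)%E.
Proof.
rewrite integral_normal_prob; last 2 first.
- apply/measurable_EFinP; apply: measurable_funX; exact: normr_measurable.
- by move=> x; rewrite lee_fin exprn_ge0.
pose K := s ^+ n * ((3 * n)%:R ^+ n * 2).
have K0 : 0 <= K by rewrite !(mulr_ge0, exprn_ge0) // ltW.
(* Part of the Gaussian decay absorbs the monomial, the rest is, up to the
   factor 2, the density with standard deviation [2 * s]. *)
apply: (@le_trans _ _ (\int[leb]_x (K%:E * (normal_pdf 0 (2 * s) x)%:E)))%E; last first.
  rewrite ge0_integralZl //; last first.
  - by move=> x _; rewrite lee_fin normal_pdf_ge0.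
  - apply/measurable_EFinP; exact: measurable_normal_pdf.
  by rewrite integral_normal_pdf mule1.
apply: ge0_le_integral => //.
- by move=> x _; rewrite -EFinM lee_fin mulr_ge0 ?exprn_ge0 ?normal_pdf_ge0.
- apply/measurable_EFinP/measurable_funM; last exact: measurable_normal_pdf.
  apply: measurable_funX; exact: normr_measurable.
- apply/measurable_EFinP/measurable_funM => //; exact: measurable_normal_pdf.
move=> x _; rewrite -!EFinM lee_fin normal_pdf0E normal_pdfE ?mulf_neq0 //.
rewrite /normal_fun subr0.
have peakE : normal_peak (2 * s) = 2^-1 * normal_peak s.
  rewrite /normal_peak exprMn -[_ * s ^+ 2 * pi]mulrA -mulrnAr.
  by rewrite sqrtrM ?sqr_ge0 // sqrtr_sqr ger0_norm // invfM.
pose u := x ^+ 2 / s ^+ 2.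
have u0 : 0 <= u by rewrite divr_ge0 ?sqr_ge0.
have -> : - x ^+ 2 / (s ^+ 2 *+ 2) = - (u * (3 / 8)) + (- (u / 8)).
  by rewrite /u -mulr_natr; field.
have -> : - x ^+ 2 / ((2 * s) ^+ 2 *+ 2) = - (u / 8).
  by rewrite /u -mulr_natr; field.
rewrite expRD peakE /K.
have -> : s ^+ n * ((3 * n)%:R ^+ n * 2) * (2^-1 * normal_peak s * expR (- (u / 8)))
  = s ^+ n * (3 * n)%:R ^+ n * (normal_peak s * expR (- (u / 8))) by field.
have -> : `|x| ^+ n * (normal_peak s * (expR (- (u * (3 / 8))) * expR (- (u / 8))))
  = `|x| ^+ n * expR (- (u * (3 / 8))) * (normal_peak s * expR (- (u / 8))) by ring.
apply: ler_wpM2r; first by rewrite mulr_ge0 ?expR_ge0 ?normal_peak_ge0.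
rewrite expRN ler_pdivrMr ?expR_gt0 //.
have [->|n0] := eqVneq n 0%N.
  by rewrite !expr0 !mul1r -expR0 ler_expR mulr_ge0.
have np : 0 < n%:R :> R by rewrite ltr0n lt0n.
pose t := u * (3 / 8) / n%:R.
have -> : u * (3 / 8) = n%:R * t by rewrite /t [RHS]mulrC divfK // gt_eqF.
(* [1 + u <= 3 n (1 + t) <= 3 n exp t]. *)
rewrite mulrC expRM_natl -exprMn -exprMn; apply: lerXn2r; rewrite ?nnegrE //.
  by rewrite !mulr_ge0 ?expR_ge0 // ltW.
have xs : `|x| <= s * (1 + u).
  rewrite -ler_pdivrMl // mulrC.
  have -> : u = (`|x| / s) ^+ 2 by rewrite exprMn real_normK ?num_real // exprVn.
  (* This square gives [y <= y ^+ 2 + 4^-1] for [y = |x| / s], hence [y <= 1 + u]. *)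
  have := sqr_ge0 (`|x| / s - 2^-1).
  by set y := `|x| / s; rewrite sqrrB; lra.
apply: (le_trans xs); rewrite [expR t * _]mulrC -mulrA; apply: ler_wpM2l; first exact: ltW.
apply: (@le_trans _ _ ((3 * n)%:R * (1 + t))); last first.
  by apply: ler_wpM2l => //; exact: expR_ge1Dx.
have -> : (3 * n)%:R * (1 + t) = 3 * n%:R + 9 / 8 * u.
  by rewrite /t natrM; field; rewrite gt_eqF.
have : 1 <= n%:R :> R by rewrite ler1n lt0n.
by lra.
Qed.

Lemma is_derive_normal_pdf0 (x : R) : is_derive x 1 pdf (- (x / s ^+ 2) * pdf x).
Proof.
pose q : R -> R := (- (s ^+ 2 *+ 2)^-1) *: (id ^+ 2).
have dq : is_derive x 1 q (- (s ^+ 2 *+ 2)^-1 *: ((x *+ 2) *: 1)).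
  apply: is_deriveZ; have := @is_deriveX R R id 2 x 1 1 (is_derive_id _ _).
  by rewrite /= expr1 mulr_natl.
have pdfE : pdf = normal_peak s *: (expR \o q).
  apply/funext => y; rewrite normal_pdf0E /q /GRing.scale /=.
  by congr (_ * expR _); rewrite !fctE /GRing.scale /= !mulNr mulrC.
have pdfxE : pdf x = normal_peak s * expR (q x) by rewrite pdfE.
have de : is_derive x 1 (expR \o q) (expR (q x) * (- (s ^+ 2 *+ 2)^-1 *: ((x *+ 2) *: 1))).
  exact: is_derive1_comp.
rewrite pdfxE [X in is_derive _ _ X]pdfE.
apply: (@is_derive_eq _ _ _ _ _ _ _ _ (is_deriveZ _ _)).
move: (expR (q x)) => e; move: (normal_peak s) => k.
rewrite /GRing.scale /=; field.
exact: s_neq0.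
Qed.

(* [(x ^+ 2 - s ^+ 2) * pdf x], of which [G] is an antiderivative, has a
   constant sign on each side of [s]; this allows the use of the fundamental
   theorem for nonnegative functions on the unbounded half. *)
Let G (x : R) : R := - s ^+ 2 * (x * pdf x).

Let is_derive_G (x : R) : is_derive x 1 G ((x ^+ 2 - s ^+ 2) * pdf x).
Proof.
have -> : G = (- s ^+ 2) *: (id * pdf) by apply/funext => y.
have := is_derive_normal_pdf0 x => d1.
apply: (@is_derive_eq _ _ _ _ _ _ _ _ (is_deriveZ _ _)).
rewrite /GRing.scale /=; field.
exact: s_neq0.
Qed.

Let continuous_G : continuous G.
Proof.
move=> x; apply/differentiable_continuous/derivable1_diffP.
by have [] := is_derive_G x.
Qed.

(** The inequality [1 + y <= expR y] at [y = x ^+ 2 / (s ^+ 2 *+ 2)] bounds [x ^+ 2 * pdf x], so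
    that [G x] is at most [C / x] in absolute value. *)
Let cvg_G : G x @[x --> +oo] --> 0.
Proof.
apply/cvgr0Pnorm_le => e e0.
pose C := 2 * s ^+ 4 * normal_peak s.
have C0 : 0 <= C by rewrite !(mulr_ge0, exprn_ge0, normal_peak_ge0) // ltW.
near=> x.
have x0 : 0 < x by near: x; exact: nbhs_pinfty_gt.
have xC : C / e <= x by near: x; apply: nbhs_pinfty_ge; exact: num_real.
rewrite /G mulNr normrN ger0_norm; last first.
  by rewrite !(mulr_ge0, exprn_ge0, normal_pdf_ge0) // ltW.
rewrite normal_pdf0E mulNr expRN.
have := expR_ge1Dx (x ^+ 2 / (s ^+ 2 *+ 2)).
set E := expR _ => hE.
have E0 : 0 < E by exact: expR_gt0.
rewrite !mulrA ler_pdivrMr //.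
have hE' : x ^+ 2 <= 2 * s ^+ 2 * E.
  rewrite -ler_pdivrMl ?mulr_gt0 ?exprn_gt0 //; apply: le_trans hE.
  rewrite (_ : x ^+ 2 / (s ^+ 2 *+ 2) = (2 * s ^+ 2)^-1 * x ^+ 2); first by lra.
  by rewrite -mulr_natr; field.
rewrite -(ler_pM2r x0).
apply: (@le_trans _ _ (C * E)).
  rewrite (_ : _ * x = s ^+ 2 * normal_peak s * x ^+ 2); last by ring.
  rewrite (_ : C * E = s ^+ 2 * normal_peak s * (2 * s ^+ 2 * E)); last by rewrite /C; ring.
  by apply: ler_wpM2l => //; rewrite mulr_ge0 ?exprn_ge0 ?normal_peak_ge0 // ltW.
rewrite [X in _ <= X]mulrAC; apply: ler_wpM2r; first exact: ltW.
by rewrite [X in _ <= X]mulrC -ler_pdivrMr.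
Unshelve. all: by end_near. Qed.

Let continuous_sqr_pdf (c : R) : continuous (fun x : R => (x ^+ 2 - c) * pdf x).
Proof.
move=> x; apply: cvgM; last exact: continuous_normal_pdf.
by apply: cvgB; [exact: exprn_continuous|exact: cvg_cst].
Qed.

Local Open Scope ereal_scope.

Let m_pdf D : measurable_fun D (fun x : R => (pdf x)%:E).
Proof. by apply/measurable_EFinP/measurable_funTS; exact: measurable_normal_pdf. Qed.

Let m_sqr_pdf D c : measurable_fun D (fun x : R => ((x ^+ 2 - c) * pdf x)%:E).
Proof.
apply/measurable_EFinP/measurable_funTS; apply: continuous_measurable_fun.
exact: continuous_sqr_pdf.
Qed.

Let tail : \int[leb]_(x in `[s, +oo[) ((x ^+ 2 - s ^+ 2) * pdf x)%:E = (s ^+ 3 * pdf s)%:E.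
Proof.
rewrite (@ge0_continuous_FTC2y _ _ G s 0).
- by rewrite sub0e -EFinN /G; congr EFin; ring.
- move=> x sx; rewrite mulr_ge0 ?normal_pdf_ge0 // subr_ge0.
  by rewrite lerXn2r ?nnegrE ?(le_trans (ltW s_gt0)) // ltW.
- exact/continuous_subspaceT/continuous_sqr_pdf.
- exact: cvg_G.
- by move=> x _; have [] := is_derive_G x.
- exact/cvg_at_right_filter/continuous_G.
- by move=> x _; rewrite derive1E; apply: derive_val.
Qed.

(** The same value as in [tail]: the deficit of [x ^+ 2] below [s ^+ 2] on one side of [s] balances
    its excess on the other. *)
Let body : \int[leb]_(x in `[0%R, s]) ((s ^+ 2 - x ^+ 2) * pdf x)%:E = (s ^+ 3 * pdf s)%:E.
Proof.
rewrite (@continuous_FTC2 _ _ (- G)%R) //.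
- by rewrite -EFinB /G !fctE; congr EFin; ring.
- apply: continuous_subspaceT => x.
  rewrite (_ : (fun x => _) = (- (fun x => (x ^+ 2 - s ^+ 2) * pdf x)))%R; last first.
    by apply/funext => y; rewrite !fctE; ring.
  by apply: cvgN; exact: continuous_sqr_pdf.
- split.
  + by move=> x _; apply: derivableN; have [] := is_derive_G x.
  + apply: cvgN; exact/cvg_at_right_filter/continuous_G.
  + apply: cvgN; exact/cvg_at_left_filter/continuous_G.
- move=> x _; rewrite derive1E; apply: derive_val.
  have := is_derive_G x => d1; apply: (@is_derive_eq _ _ _ _ _ _ _ _ (is_deriveN _)).
  by ring.
Qed.

(** By parity the integral is twice that over the half-line, which is cut at [s]. The boundary terms
    of [tail] and [body] cancel and leave [s ^+ 2] times half of the total mass. *)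
Lemma normal_second_moment : \int[N]_x (x ^+ 2)%:E = (s ^+ 2)%:E.
Proof.
rewrite integral_normal_prob; last 2 first.
- by apply/measurable_EFinP; exact: measurable_funX.
- by move=> x; rewrite lee_fin sqr_ge0.
(* Subtracting 0 gives [f] the shape of [continuous_sqr_pdf] and [m_sqr_pdf] at [c = 0]. *)
pose f (x : R) := ((x ^+ 2 - 0) * pdf x)%R.
have f0 x : (0 <= f x)%R by rewrite /f subr0 mulr_ge0 ?sqr_ge0 ?normal_pdf_ge0.
have mf D : measurable_fun D (EFin \o f) by exact: m_sqr_pdf.
transitivity (\int[leb]_x (f x)%:E).
  by apply: eq_integral => x _; rewrite /f subr0 -EFinM.
have half : [set x : R | (0 <= x)%R] = `[0%R, s[ `|` `[s, +oo[.
  apply/seteqP; split=> [x /=|x /= []]; rewrite !in_itv /= ?andbT.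
  - by move=> x0; case: (ltP x s) => xs; [left|right]; rewrite ?x0 ?xs.
  - by case/andP.
  - by apply: le_trans; exact: ltW.
have disj : [disjoint `[0%R, s[ & `[s, +oo[].
  apply/disj_set2P/seteqP; split => x //= []; rewrite !in_itv /= andbT.
  by move=> /andP[_ xs]; rewrite leNgt xs.
have halfE (g : R -> R) : (forall x, 0 <= g x)%R -> (forall D, measurable_fun D (EFin \o g)) ->
    \int[leb]_(x in [set x : R | (0 <= x)%R]) (g x)%:E =
    \int[leb]_(x in `[0%R, s]) (g x)%:E + \int[leb]_(x in `[s, +oo[) (g x)%:E.
  move=> g0 mg; rewrite half ge0_integral_setU //=; last by move=> x _; rewrite lee_fin.
  - by rewrite integral_itv_bndo_bndc.
  - exact: mg.
have pdf0 x : (0 <= pdf x)%R by exact: normal_pdf_ge0.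
have half_pdf : \int[leb]_(x in `[0%R, s]) (pdf x)%:E + \int[leb]_(x in `[s, +oo[) (pdf x)%:E
    = (2^-1)%:E.
  have := integral_normal_pdf 0 s; rewrite ge0_symfun_integralT //; last 2 first.
  - exact: continuous_normal_pdf.
  - by move=> x; rewrite /= normal_pdf0N.
  rewrite (halfE pdf) // => /(congr1 (mule (2^-1)%:E)).
  by rewrite muleA -EFinM mulVf // mul1e mule1.
rewrite ge0_symfun_integralT //; last 2 first.
- exact: continuous_sqr_pdf.
- by move=> x; rewrite /f /= sqrrN normal_pdf0N.
rewrite (halfE f) //.
have -> : \int[leb]_(x in `[s, +oo[) (f x)%:E =
   (s ^+ 3 * pdf s)%:E + (s ^+ 2)%:E * \int[leb]_(x in `[s, +oo[) (pdf x)%:E.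
  rewrite -tail -ge0_integralZl //; last by rewrite lee_fin exprn_ge0 // ltW.
  rewrite -ge0_integralD //.
  - by apply: eq_integral => x _; rewrite -EFinM -EFinD /f; congr EFin; ring.
  - move=> x /=; rewrite in_itv /= andbT => sx.
    rewrite lee_fin mulr_ge0 ?normal_pdf_ge0 // subr_ge0.
    by rewrite lerXn2r ?nnegrE ?(le_trans (ltW s_gt0)) // ltW.
  - exact: m_sqr_pdf.
  - by move=> x _; rewrite -EFinM lee_fin mulr_ge0 ?exprn_ge0 // ltW.
  - by apply/measurable_EFinP/measurable_funTS/measurable_funM => //; exact: measurable_normal_pdf.
  - exact: m_pdf.
  - by move=> x _; rewrite lee_fin.
rewrite addeA.
have -> : \int[leb]_(x in `[0%R, s]) (f x)%:E + (s ^+ 3 * pdf s)%:E =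
   (s ^+ 2)%:E * \int[leb]_(x in `[0%R, s]) (pdf x)%:E.
  rewrite -body -ge0_integralZl //; last by rewrite lee_fin exprn_ge0 // ltW.
  rewrite -ge0_integralD //.
  - by apply: eq_integral => x _; rewrite -EFinM -EFinD /f; congr EFin; ring.
  - by move=> x _; rewrite lee_fin.
  - exact: mf.
  - move=> x /=; rewrite in_itv /= => /andP[x0 xs].
    by rewrite lee_fin mulr_ge0 ?normal_pdf_ge0 // subr_ge0 lerXn2r ?nnegrE // ltW.
  - apply/measurable_EFinP/measurable_funTS/measurable_funM; last exact: measurable_normal_pdf.
    by apply: measurable_funB => //; exact: measurable_funX.
  - exact: m_pdf.
  - by move=> x _; rewrite lee_fin.
rewrite -ge0_muleDr; last 2 first.
- by apply: integral_ge0 => x _; rewrite lee_fin.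
- by apply: integral_ge0 => x _; rewrite lee_fin.
by rewrite half_pdf -!EFinM; congr EFin; field.
Qed.

End normal_moments.

(** Both sides are compared with the maximum [M] of 1 and the [y j]: the left sum has [m.+1] terms,
    each at most [M], and [M ^+ k] is one of the nonnegative terms on the right. *)
Lemma sum_exprn_le (R : realType) (m k : nat) (y : 'I_m -> R) :
  (forall j, 0 <= y j) ->
  (1 + \sum_(j < m) y j) ^+ k <= m.+1%:R ^+ k * (1 + \sum_(j < m) y j ^+ k).
Proof.
move=> y0; pose M := \big[Num.max/1]_(j < m) y j.
have yM j : y j <= M by exact: le_bigmax.
have M1 : 1 <= M by exact: bigmax_ge_id.
have Mk : M ^+ k <= 1 + \sum_(j < m) y j ^+ k.
  have s0 (P : pred 'I_m) : 0 <= \sum_(j < m | P j) y j ^+ k.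
    by apply: sumr_ge0 => j _; rewrite exprn_ge0.
  rewrite /M; apply: (big_ind (fun M => M ^+ k <= 1 + \sum_(j < m) y j ^+ k)).
  - by rewrite expr1n lerDl.
  - by move=> a b; rewrite /Num.max; case: ifP.
  - by move=> j _; rewrite (bigD1 j) //= addrCA lerDl addr_ge0.
apply: (@le_trans _ _ ((m.+1%:R * M) ^+ k)); last first.
  by rewrite exprMn ler_wpM2l // exprn_ge0.
apply: lerXn2r; rewrite ?nnegrE ?addr_ge0 ?sumr_ge0 ?mulr_ge0 ?(le_trans _ M1) //.
rewrite -natr1 mulrDl mul1r addrC lerD // -[m in m%:R]card_ord mulr_natl -sumr_const.
exact: ler_sum.
Qed.

(** * Moments and symmetries of the law of a Brownian increment *)

Section increment_law.
Context {R : realType} {m : nat}.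
Variables (nu : probability (borelMx R m 1) R) (s : R).
Hypothesis s_gt0 : 0 < s.
Hypothesis nu_box : forall B : 'I_m -> set R, (forall i, measurable (B i)) ->
  nu [set z | forall i, B i ((z : 'cV[R]_m) i 0)] =
  (\prod_(i < m) normal_prob 0 s (B i))%E.

Let coord (i : 'I_m) (z : borelMx R m 1) : measurableTypeR R := (z : 'cV[R]_m) i 0.

Let m_coord i : measurable_fun setT (coord i).
Proof. exact: measurable_coord. Qed.
Hint Resolve m_coord : core.

Local Open Scope ereal_scope.

(** The marginal law is read off from the boxes that constrain the coordinate [i] alone: all other
    factors are 1. *)
Lemma integral_coord (i : 'I_m) (f : R -> \bar R) :
  measurable_fun setT f -> (forall x, 0 <= f x) ->
  \int[nu]_z f ((z : 'cV[R]_m) i 0%R) = \int[normal_prob 0 s]_x f x.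
Proof.
move=> mf f0; rewrite -[LHS](@ge0_integral_pushforward _ _ _ _ _ _ (m_coord i) nu setT) //.
apply: eq_measure_integral => A mA _; rewrite /= /pushforward.
pose B j := if j == i then A else setT.
have mB j : measurable (B j) by rewrite /B; case: ifP.
have := nu_box mB; rewrite (bigD1 i) //= [X in _ = _ * X]big1; last first.
  by move=> j /negPf ji; rewrite /B ji; exact: probability_setT.
rewrite mule1 /B eqxx => <-; congr (nu _); apply/seteqP; split=> z /=.
  by move=> Az j; case: eqP => // ->.
by move=> /(_ i); rewrite eqxx.
Qed.

(** Flipping all signs symmetrizes the Taylor expansion; flipping a single one removes the mixed
    second moments. *)
Definition flip (e : 'I_m -> bool) (z : 'cV[R]_m) : 'cV[R]_m :=
  \col_i ((-1) ^+ e i * z i 0)%R.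

Lemma measurable_flip e :
  measurable_fun setT (flip e : borelMx R m 1 -> borelMx R m 1).
Proof.
apply: measurable_fun_borelMx => // i j; rewrite ord1.
under eq_fun do rewrite mxE.
by apply: measurable_funM => //; exact: m_coord.
Qed.

(** Each normal factor is symmetric, so a flip preserves the measure of every box and therefore the
    law. *)
Lemma integral_flip e (f : 'cV[R]_m -> \bar R) :
  measurable_fun setT (f : borelMx R m 1 -> \bar R) -> (forall z, 0 <= f z) ->
  \int[nu]_z f (flip e z) = \int[nu]_z f z.
Proof.
move=> mf f0.
rewrite -[LHS](@ge0_integral_pushforward _ _ _ _ _ _ (measurable_flip e) nu setT (f : borelMx R m 1 -> _)) //.
apply: eq_measure_integral => [|mfl A mA _]; first exact: measurable_flip.
apply: eq_measure_boxes => //.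
  by rewrite /= /pushforward preimage_setT probability_setT ltry.
move=> B mB.
have boxE : box B = [set z : 'cV[R]_m | forall i, B i 0%R (z i 0%R)].
  by apply/seteqP; split=> z zB i => [|j]; rewrite ?ord1; exact: zB.
pose C i := if e i then (-%R @^-1` B i 0%R)%R else B i 0%R.
have mC i : measurable (C i).
  rewrite /C; case: ifP => // _; rewrite -[X in measurable X]setTI.
  exact: oppr_measurable.
transitivity (nu [set z | forall i, C i ((z : 'cV[R]_m) i 0%R)]).
  rewrite /= /pushforward boxE; congr (nu _); apply/seteqP; split=> z zB i; have := zB i.
    by rewrite /flip mxE /C; case: (e i); rewrite ?expr1 ?expr0 ?mulN1r ?mul1r.
  by rewrite /C /flip mxE; case: (e i); rewrite ?expr1 ?expr0 ?mulN1r ?mul1r.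
rewrite boxE (nu_box mC).
apply: etrans (esym (@nu_box (fun i => B i 0%R) (fun i => mB i 0%R))).
apply: eq_bigr => i _; rewrite /C; case: ifP => // _.
exact: normal_prob_opp.
Qed.

(** The constants of [sum_exprn_le] and [normal_moment_le] put together; it is free of the standard
    deviation, hence of the step size. *)
Definition moment_const (k : nat) : R :=
  (m.+1%:R ^+ k * (1 + m%:R * ((3 * k)%:R ^+ k * 2)))%R.

Let N (z : 'cV[R]_m) : R := (s^-1 * \sum_(j < m) `|z j 0|)%R.

Lemma measurable_l1 : measurable_fun setT (N : borelMx R m 1 -> R).
Proof.
apply: measurable_funM => //; apply: measurable_sum => j.
by apply: measurableT_comp => //; exact: m_coord.
Qed.

Lemma moment_l1_le k :
  \int[nu]_z ((1 + N z) ^+ k)%:E <= (moment_const k)%:E.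
Proof.
have si0 : (0 <= s^-1)%R by rewrite invr_ge0 ltW.
have mabs j : measurable_fun setT (fun z : borelMx R m 1 => ((s^-1 * `|(z : 'cV[R]_m) j 0|) ^+ k)%:E).
  apply/measurable_EFinP; apply: measurable_funX; apply: measurable_funM => //.
  by apply: measurableT_comp => //; exact: m_coord.
have pos j (z : 'cV[R]_m) : (0 <= (s^-1 * `|z j 0|) ^+ k)%R by rewrite exprn_ge0 // mulr_ge0.
apply: (@le_trans _ _ (\int[nu]_z ((m.+1%:R ^+ k)%:E * (1 + \sum_(j < m) ((s^-1 * `|(z : 'cV[R]_m) j 0|) ^+ k)%:E)))).
  apply: ge0_le_integral => //.
  - move=> z _; rewrite lee_fin exprn_ge0 // addr_ge0 // mulr_ge0 //.
    by apply: sumr_ge0.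
  - apply/measurable_EFinP; apply: measurable_funX; apply: measurable_funD => //.
    exact: measurable_l1.
  - apply: emeasurable_funM => //; apply: emeasurable_funD => //.
    exact: emeasurable_sum.
  - move=> z _; rewrite sumEFin -EFinD -EFinM lee_fin /N mulr_sumr.
    by apply: sum_exprn_le => j; rewrite mulr_ge0.
have E j : \int[nu]_z ((s^-1 * `|(z : 'cV[R]_m) j 0|) ^+ k)%:E <= ((3 * k)%:R ^+ k * 2)%:E.
  rewrite (integral_coord j (f := fun x : R => ((s^-1 * `|x|) ^+ k)%:E)); last 2 first.
  - apply/measurable_EFinP; apply: measurable_funX; apply: measurable_funM => //.
  - by move=> x; rewrite lee_fin exprn_ge0 // mulr_ge0.
  under eq_integral do rewrite exprMn EFinM.
  rewrite ge0_integralZl //; last 2 first.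
  - by apply/measurable_EFinP; apply: measurable_funX.
  - by rewrite lee_fin exprn_ge0.
  apply: (@le_trans _ _ ((s^-1 ^+ k)%:E * (s ^+ k * ((3 * k)%:R ^+ k * 2))%:E)).
    by apply: lee_wpmul2l; [rewrite lee_fin exprn_ge0|exact: normal_moment_le].
  by rewrite -EFinM lee_fin exprVn mulKf // gt_eqF // exprn_gt0.
rewrite ge0_integralZl //; last 2 first.
- by apply: emeasurable_funD => //; exact: emeasurable_sum.
- by move=> z _; rewrite adde_ge0 // sume_ge0 // => j _; rewrite lee_fin.
rewrite /moment_const EFinM; apply: lee_wpmul2l; first by rewrite lee_fin exprn_ge0.
rewrite ge0_integralD //; last 2 first.
- by move=> z _; rewrite sume_ge0 // => j _; rewrite lee_fin.
- exact: emeasurable_sum.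
rewrite integral_cst //= probability_setT mule1 EFinD; apply: leeD => //.
rewrite ge0_integral_sum //; last by move=> j z _; rewrite lee_fin.
apply: (@le_trans _ _ (\sum_(j < m) ((3 * k)%:R ^+ k * 2)%:E)); first exact: lee_sum.
by rewrite sumEFin sumr_const card_ord mulr_natl.
Qed.

Lemma integrable_coordM (i j : 'I_m) :
  nu.-integrable setT (fun z => ((z : 'cV[R]_m) i 0 * (z : 'cV[R]_m) j 0)%:E).
Proof.
apply: (@le_integrable _ (borelMx R m 1) R nu setT measurableT _ (fun z => (s ^+ 2 * (1 + N z) ^+ 2)%:E)).
- by apply/measurable_EFinP/measurable_funM; exact: m_coord.
- move=> z _; rewrite lee_fin normrM.
  have Nz l : (`|z l 0| <= s * (1 + N z))%R.
    rewrite /N mulrDr mulr1 mulVKf ?gt_eqF // (bigD1 l) //= addrCA lerDl.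
    by rewrite addr_ge0 ?sumr_ge0 // ltW.
  rewrite [X in (_ <= X)%R]ger0_norm; last by rewrite mulr_ge0 // sqr_ge0.
  by rewrite -exprMn expr2 ler_pM.
- under eq_fun do rewrite EFinM.
  apply: integrableZl => //; apply/integrableP; split.
    apply/measurable_EFinP; apply: measurable_funX; apply: measurable_funD => //.
    exact: measurable_l1.
  under eq_integral do rewrite abse_EFin ger0_norm ?sqr_ge0 //.
  exact: (le_lt_trans (moment_l1_le 2)) (ltry _).
Qed.

(** For [i != j], flipping the coordinate [i] alone preserves the law and changes the sign of the
    integrand, so the integral equals its opposite. *)
Lemma integral_coordM (i j : 'I_m) :
  \int[nu]_z ((z : 'cV[R]_m) i 0 * (z : 'cV[R]_m) j 0)%:E
  = (if i == j then s ^+ 2 else 0)%:E.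
Proof.
case: eqVneq => [<-|ij].
  rewrite -(normal_second_moment s_gt0) -(integral_coord i) //.
  - by apply/measurable_EFinP; exact: measurable_funX.
  - by move=> x; rewrite lee_fin sqr_ge0.
pose f (z : 'cV[R]_m) := (z i 0 * z j 0)%:E : \bar R.
have fI : nu.-integrable setT f by exact: integrable_coordM.
pose e (l : 'I_m) := l == i.
have fe z : f (flip e z) = - f z.
  by rewrite /f /flip !mxE /e eqxx eq_sym (negPf ij) expr1 expr0 mulN1r mul1r mulNr.
(* As [integral_flip] is about nonnegative integrands, it is applied to the positive and the
   negative part. *)
have E : \int[nu]_z f z = - \int[nu]_z f z.
  have mfp : measurable_fun setT (f^\+ : borelMx R m 1 -> \bar R).
    by apply: measurable_funepos; exact: measurable_int fI.
  have mfn : measurable_fun setT (f^\- : borelMx R m 1 -> \bar R).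
    by apply: measurable_funeneg; exact: measurable_int fI.
  rewrite [LHS]integralE -(integral_flip e mfp) // -(integral_flip e mfn) //.
  rewrite -[RHS]integralN; last exact: integrable_add_def fI.
  rewrite [RHS]integralE; congr (_ - _); apply: eq_integral => z _.
    by rewrite !funeposE fe.
  by rewrite !funenegE fe.
have : \int[nu]_z f z \is a fin_num by exact: integrable_fin_num.
move: E; case: (\int[nu]_z f z) => // r [] /eqP.
by rewrite -subr_eq0 opprK -mulr2n mulrn_eq0 /= => /eqP ->.
Qed.

Lemma integrable_quad (Q : 'M[R]_m) :
  nu.-integrable setT (fun z =>
    (\sum_(i < m) \sum_(j < m) Q i j * ((z : 'cV[R]_m) i 0 * (z : 'cV[R]_m) j 0))%:E).
Proof.
under eq_fun do rewrite -sumEFin; apply: integrable_sum => // i _.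
under eq_fun do rewrite -sumEFin; apply: integrable_sum => // j _.
under eq_fun do rewrite EFinM; apply: integrableZl => //.
exact: integrable_coordM.
Qed.

Lemma integral_quad (Q : 'M[R]_m) :
  \int[nu]_z (\sum_(i < m) \sum_(j < m)
     Q i j * ((z : 'cV[R]_m) i 0 * (z : 'cV[R]_m) j 0))%:E
  = (s ^+ 2 * \tr Q)%:E.
Proof.
have IQ i j : nu.-integrable setT (fun z =>
    (Q i j * ((z : 'cV[R]_m) i 0 * (z : 'cV[R]_m) j 0))%:E).
  under eq_fun do rewrite EFinM; apply: integrableZl => //.
  exact: integrable_coordM.
under eq_integral do rewrite -sumEFin.
rewrite integral_sum //; last first.
  move=> i; under eq_fun do rewrite -sumEFin.
  by apply: integrable_sum => // j _; exact: IQ.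
rewrite /mxtrace mulr_sumr -sumEFin; apply: eq_bigr => i _.
under eq_integral do rewrite -sumEFin.
rewrite integral_sum // (bigD1 i) //= big1 => [|j ji].
  rewrite adde0; under eq_integral do rewrite EFinM.
  rewrite integralZl //; last exact: integrable_coordM.
  by rewrite integral_coordM eqxx -EFinM mulrC.
under eq_integral do rewrite EFinM.
rewrite integralZl //; last exact: integrable_coordM.
by rewrite integral_coordM eq_sym (negPf ji) mule0.
Qed.

End increment_law.

Lemma quad_formE (R : comPzRingType) (n : nat) (Q : 'M[R]_n) (z : 'cV[R]_n) :
  \sum_(i < n) \sum_(j < n) Q i j * (z i 0 * z j 0) = (z^T *m Q *m z) 0 0.
Proof.
rewrite mxE exchange_big; apply: eq_bigr => j _.
rewrite mxE mulr_suml; apply: eq_bigr => i _.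
by rewrite mxE [z i 0 * Q i j]mulrC mulrA.
Qed.

Lemma hsnorm_coord (R : realType) (m n : nat) (A : 'M[R]_(m, n)) i j :
  `|A i j| <= hsnorm A.
Proof.
rewrite /hsnorm -sqrtr_sqr ler_wsqrtr // (bigD1 i) //= (bigD1 j) //= -addrA.
rewrite lerDl addr_ge0 // ?sumr_ge0 // => l _; first exact: sqr_ge0.
by apply: sumr_ge0 => k _; exact: sqr_ge0.
Qed.

(** The space [T] is arbitrary because three are used: that of the increment, [Omega] with a
    sigma-algebra of the filtration, and the product of state and increment spaces. *)
Lemma measurable_affine_step (R : realType) (d m : nat) dT (T : measurableType dT)
    (x a : T -> 'cV[R]_d) (S : T -> 'M[R]_(d, m)) (z : T -> 'cV[R]_m) :
  (forall i, measurable_fun setT (fun t => x t i 0)) ->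
  (forall i, measurable_fun setT (fun t => a t i 0)) ->
  (forall i j, measurable_fun setT (fun t => S t i j)) ->
  (forall i, measurable_fun setT (fun t => z t i 0)) ->
  measurable_fun setT (fun t => x t + (a t + S t *m z t) : borelMx R d 1).
Proof.
move=> mx ma mS mz; apply: measurable_fun_borelMx => // i j; rewrite ord1.
under eq_fun do rewrite !mxE.
apply: measurable_funD => //; apply: measurable_funD => //.
by apply: measurable_sum => k; exact: measurable_funM.
Qed.

(** * Expectation of [V] after one step from a fixed point *)

Section one_step.
Context {R : realType} {d m : nat}.
Variables (p : nat) (gamma mu c : R) (V : 'cV[R]_d -> R).
Hypotheses (p_ge2 : (2 <= p)%N) (V_class : class_C p.+1 V)
  (V_poly : forall x (i : p.+1.-tuple 'I_d), iter_partial V i x = 0)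
  (V_ge0 : forall x, 0 <= V x) (c_ge0 : 0 <= c) (mu_ge0 : 0 <= mu)
  (V_growth : forall (x : 'cV[R]_d) (s : nat), (s <= p)%N ->
     tensor_hsnorm V s x <= c * (1 + V x) `^ (1 - s%:R * gamma)).

(** This is the constant [rhot] of the theorem: the errors of all orders, integrated against the
    moments of the normalized increment. *)
Definition step_const : R :=
  \sum_(t < p.+1) c * (d%:R * mu) ^+ t * @moment_const R m t.

Lemma moment_const_ge0 t : 0 <= @moment_const R m t.
Proof. by rewrite !(mulr_ge0, addr_ge0, exprn_ge0). Qed.

Lemma step_const_ge0 : 0 <= step_const.
Proof.
by apply: sumr_ge0 => t _; rewrite !(mulr_ge0, exprn_ge0, moment_const_ge0).
Qed.

Lemma measurable_class_C : measurable_fun setT (V : borelMx R d 1 -> R).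
Proof. by apply: measurable_borelMx_fun; have [] := @V_class [::] isT. Qed.

(* [r] stands for [h ^ (1/4)]: the increment has standard deviation [r ^+ 2]. *)
Variables (r : R) (nu : probability (borelMx R m 1) R).
Hypotheses (r_gt0 : 0 < r) (r_le1 : r <= 1).
Hypothesis nu_box : forall B : 'I_m -> set R, (forall i, measurable (B i)) ->
  nu [set z | forall i, B i ((z : 'cV[R]_m) i 0)] =
  (\prod_(i < m) normal_prob 0 (r ^+ 2) (B i))%E.

Variables (x a : 'cV[R]_d) (S : 'M[R]_(d, m)).
Let A := mu * (1 + V x) `^ gamma.
Hypothesis a_le : forall i, `|a i 0| <= r ^+ 2 * A.
Hypothesis S_le : hsnorm S * r <= A.

Let N (z : 'cV[R]_m) : R := (r ^+ 2)^-1 * \sum_(j < m) `|z j 0|.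

Let r2_gt0 : 0 < r ^+ 2. Proof. by rewrite exprn_gt0. Qed.

Let N_ge0 z : 0 <= N z.
Proof. by rewrite mulr_ge0 ?sumr_ge0 // invr_ge0 ltW. Qed.

(** The taming bound gives entries of [S] at most [A / r], and the entries of [z] sum in absolute
    value to [r ^+ 2 * N z]. *)
Let Sz_le z i : `|(S *m z) i 0| <= r * A * N z.
Proof.
rewrite mxE (le_trans (ler_norm_sum _ _ _)) //.
rewrite /N (_ : r * A * _ = A / r * \sum_(j < m) `|z j 0|); last first.
  by field; rewrite gt_eqF.
rewrite mulr_sumr; apply: ler_sum => j _; rewrite normrM ler_wpM2r //.
by rewrite ler_pdivlMr // (le_trans _ S_le) // ler_wpM2r ?hsnorm_coord // ltW.
Qed.

Local Open Scope ereal_scope.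

Let V1_ge0 : (0 <= 1 + V x)%R. Proof. by rewrite addr_ge0. Qed.

(** By symmetry of the law, [V] may be averaged over [z] and [- z], and [taylor_sym_bound] applies.
    Its quadratic part integrates to the trace, the covariance being [r ^+ 4] times the identity,
    and its remainder is bounded through [moment_l1_le]. *)
Lemma one_step_bound :
  \int[nu]_z (V (x + (a + S *m (z : 'cV[R]_m))))%:E <=
  (V x + \sum_(i < d) a i 0 * iter_partial V [:: i] x
   + 2^-1 * (r ^+ 4 * \tr (hessianV V x *m S *m S^T))
   + r ^+ 4 * (1 + V x) * step_const)%:E.
Proof.
pose L (z : 'cV[R]_m) := V (x + (a + S *m z)).
have mL : measurable_fun setT (fun z : borelMx R m 1 => (L z)%:E).
  apply/measurable_EFinP; apply: (measurableT_comp measurable_class_C).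
  by apply: measurable_affine_step => //= i; exact: measurable_coord.
have flipN (z : 'cV[R]_m) : flip (fun=> true) z = (- z)%R.
  by apply/colP => i; rewrite !mxE mulN1r.
have mLN : measurable_fun setT (fun z : borelMx R m 1 => (L (flip (fun=> true) z))%:E).
  exact: (measurableT_comp mL (measurable_flip _)).
have L0 z : (0 <= L z)%R by exact: V_ge0.
(* The transpose reflects the index order [[:: j; i]] in [taylor_sym_bound]; it is undone at the end
   under the trace. *)
pose Q := (S^T *m (hessianV V x)^T *m S)%R.
pose q (z : 'cV[R]_m) := (\sum_(i < m) \sum_(j < m) Q i j * (z i 0 * z j 0))%R.
pose C0 := (V x + \sum_(i < d) a i 0 * iter_partial V [:: i] x)%R.
pose B (z : 'cV[R]_m) := (r ^+ 4 * (1 + V x) *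
    (\sum_(t < p.+1) c * (d%:R * mu * (1 + N z)) ^+ t))%R.
have symL z : (2^-1 * (L z + L (- z)) <= (C0 + 2^-1 * q z) + B z)%R.
  have := taylor_sym_bound V_class V_poly V_ge0 c_ge0 mu_ge0 V_growth
    (ltW r_gt0) r_le1 (N_ge0 z) a_le (Sz_le z) p_ge2.
  rewrite /L mulmxN /C0 /q quad_formE => /le_trans; apply.
  rewrite lerD2r lerD2l ler_wpM2l // le_eqVlt; apply/orP; left; apply/eqP.
  rewrite [RHS](_ : _ = ((S *m z)^T *m (hessianV V x)^T *m (S *m z)) 0 0)%R; last first.
    by rewrite /Q trmx_mul !mulmxA.
  rewrite -quad_formE; apply: eq_bigr => i _; apply: eq_bigr => j _.
  by rewrite !mxE mulrC.
have r_ge0 := ltW r_gt0.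
have rV0 : (0 <= r ^+ 4 * (1 + V x))%R by rewrite mulr_ge0 // exprn_ge0.
have N1_ge0 z : (0 <= 1 + N z)%R by rewrite addr_ge0.
have P_ge0 z t : (0 <= c * (d%:R * mu * (1 + N z)) ^+ t)%R.
  by rewrite mulr_ge0 // exprn_ge0 // mulr_ge0 // mulr_ge0.
have B0 z : (0 <= B z)%R by apply: mulr_ge0 => //; apply: sumr_ge0.
have mB : measurable_fun setT (fun z : borelMx R m 1 => (B z)%:E).
  apply/measurable_EFinP; apply: measurable_funM => //.
  apply: measurable_sum => t; apply: measurable_funM => //.
  apply: measurable_funX; apply: measurable_funM => //.
  by apply: measurable_funD => //; exact: measurable_l1.
have iB : \int[nu]_z (B z)%:E <= (r ^+ 4 * (1 + V x) * step_const)%:E.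
  under eq_integral do rewrite EFinM.
  rewrite ge0_integralZl //; last 2 first.
  - apply/measurable_EFinP; apply: measurable_sum => t; apply: measurable_funM => //.
    apply: measurable_funX; apply: measurable_funM => //.
    by apply: measurable_funD => //; exact: measurable_l1.
  - move=> z _; rewrite lee_fin; exact: sumr_ge0.
  rewrite [leRHS]EFinM; apply: lee_wpmul2l => //.
  under eq_integral do rewrite -sumEFin.
  rewrite ge0_integral_sum //; last 2 first.
  - move=> t; apply/measurable_EFinP; apply: measurable_funM => //.
    apply: measurable_funX; apply: measurable_funM => //.
    by apply: measurable_funD => //; exact: measurable_l1.
  - by move=> t z _; rewrite lee_fin.
  rewrite /step_const -sumEFin; apply: lee_sum => t _.
  under eq_integral do rewrite exprMn mulrA EFinM.
  rewrite ge0_integralZl //; last 3 first.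
  - apply/measurable_EFinP; apply: measurable_funX.
    by apply: measurable_funD => //; exact: measurable_l1.
  - by move=> z _; rewrite lee_fin exprn_ge0.
  - by rewrite lee_fin !(mulr_ge0, exprn_ge0).
  rewrite [leRHS]EFinM; apply: lee_wpmul2l; first by rewrite lee_fin !(mulr_ge0, exprn_ge0).
  exact: moment_l1_le.
have IB : nu.-integrable setT (fun z => (B z)%:E).
  apply/integrableP; split=> //.
  under eq_integral do rewrite abse_EFin ger0_norm //.
  by apply: (le_lt_trans iB); rewrite ltry.
have Iq : nu.-integrable setT (fun z => (2^-1)%:E * (q z)%:E).
  by apply: integrableZl => //; exact: (integrable_quad r2_gt0 nu_box).
have IC : nu.-integrable setT (fun z => C0%:E).
  exact: finite_measure_integrable_cst.
have E2 : \int[nu]_z (L z)%:E = \int[nu]_z (2^-1 * (L z + L (flip (fun=> true) z)))%:E.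
  under [RHS]eq_integral do rewrite EFinM EFinD.
  rewrite ge0_integralZl //; last 2 first.
  - exact: emeasurable_funD.
  - by move=> z _; rewrite adde_ge0 // lee_fin.
  rewrite ge0_integralD //; [|by move=> z _; rewrite lee_fin ..].
  rewrite (integral_flip r2_gt0 nu_box (fun=> true) mL) => [|z]; last by rewrite lee_fin.
  rewrite ge0_muleDr ?integral_ge0 // => [|z _|z _]; rewrite ?lee_fin //.
  rewrite -ge0_muleDl // -EFinD (_ : 2^-1 + 2^-1 = 1)%R ?mul1e //.
  by field.
rewrite -/(L _) E2.
apply: (@le_trans _ _ (\int[nu]_z ((C0%:E + (2^-1)%:E * (q z)%:E) + (B z)%:E))).
  apply: ge0_le_integral => //.
  - by move=> z _; rewrite lee_fin mulr_ge0 // addr_ge0.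
  - apply/measurable_EFinP; apply: measurable_funM => //.
    by apply: measurable_funD; apply/measurable_EFinP.
  - apply: emeasurable_funD => //; apply: emeasurable_funD => //.
    exact: measurable_int Iq.
  - by move=> z _; rewrite -EFinM -!EFinD lee_fin flipN.
rewrite integralD //; last exact: integrableD.
rewrite integralD // integral_cst //= probability_setT mule1.
rewrite integralZl //; last exact: (integrable_quad r2_gt0 nu_box).
rewrite (integral_quad r2_gt0 nu_box) [leRHS]EFinD; apply: leeD => //.
rewrite -EFinM -EFinD lee_fin -exprM.
by rewrite /Q -[in leLHS]mxtrace_tr !trmx_mul !trmxK [in leLHS]mxtrace_mulC.
Qed.

End one_step.

(** Independence makes the joint law the product of the marginal laws, and Tonelli's theorem
    integrates out [Y]. It takes the place of conditioning on the past. *)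
Lemma independent_integral dO d1 d2 (Omega : measurableType dO)
    (T1 : measurableType d1) (T2 : measurableType d2) (R : realType)
    (P : probability Omega R) (X : {mfun Omega >-> T1}) (Y : {mfun Omega >-> T2})
    (f : T1 * T2 -> \bar R) :
  (forall A B, measurable A -> measurable B ->
     P (X @^-1` A `&` Y @^-1` B) = (P (X @^-1` A) * P (Y @^-1` B))%E) ->
  measurable_fun setT f -> (forall z, (0 <= f z)%E) ->
  (\int[P]_w f (X w, Y w) = \int[P]_w \int[distribution P Y]_y f (X w, y))%E.
Proof.
move=> XY mf f0.
have mXY : measurable_fun setT (fun w => (X w, Y w)).
  by apply: measurable_fun_pair; exact: measurable_funPT.
pose F x := (\int[distribution P Y]_y f (x, y))%E.
have mF : measurable_fun setT F by exact: measurable_fun_fubini_tonelli_F.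
have F0 x : (0 <= F x)%E by exact: integral_ge0.
transitivity (\int[distribution P X]_x F x)%E; last first.
  by rewrite ge0_integral_pushforward //; exact: measurable_funPT.
rewrite -fubini_tonelli1 //.
transitivity (\int[pushforward P (fun w => (X w, Y w))]_z f z)%E.
  by rewrite ge0_integral_pushforward.
apply: eq_measure_integral => A mA _; apply/esym.
by apply: product_measure_unique => // B C mB mC; rewrite /= /pushforward -XY.
Qed.

(** Adaptedness becomes measurability on the type [g_sigma_algebraType G], where the closure
    properties of measurable functions are available. *)
Lemma measurable_wrtP dO (Omega : measurableType dO) (R : realType)
    (G : set (set Omega)) (n : nat) (X : Omega -> 'cV[R]_n) :
  sigma_algebra setT G ->
  measurable_wrt G X <->
  measurable_fun setT (X : g_sigma_algebraType G -> borelMx R n 1).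
Proof.
move=> sG; split=> [mX _ B mB|mX B mB].
  by rewrite setTI; apply: sub_sigma_algebra; exact: mX.
have := mX measurableT B mB; rewrite setTI.
by rewrite (measurable_g_measurableTypeE sG).
Qed.

Lemma measurable_wrt_coordP dO (Omega : measurableType dO) (R : realType)
    (G : set (set Omega)) (n : nat) (X : Omega -> 'cV[R]_n) :
  sigma_algebra setT G ->
  measurable_wrt G X <-> forall i,
    measurable_fun setT (fun w : g_sigma_algebraType G => X w i 0 : R).
Proof.
move=> sG; split=> [/(measurable_wrtP _ sG) mX i|mX].
  exact: (measurableT_comp (measurable_coord i 0) mX).
apply/(measurable_wrtP _ sG)/measurable_fun_borelMx => // i j.
by rewrite ord1.
Qed.

Lemma measurable_wrt_measurable_fun dO (Omega : measurableType dO) (R : realType)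
    (G : set (set Omega)) (n : nat) (X : Omega -> 'cV[R]_n) :
  G `<=` measurable -> measurable_wrt G X ->
  measurable_fun setT (X : Omega -> borelMx R n 1).
Proof. by move=> Gm mX _ B mB; rewrite setTI; apply: Gm; exact: mX. Qed.

(** * The tamed scheme: adaptedness, one-step inequality and iteration *)

Section tamed_scheme.
Context {R : realType} {d m : nat}.
Variables (p : nat) (gamma mu c : R) (V : 'cV[R]_d -> R).
Hypotheses (p_ge2 : (2 <= p)%N) (V_class : class_C p.+1 V)
  (V_poly : forall x (i : p.+1.-tuple 'I_d), iter_partial V i x = 0)
  (V_ge0 : forall x, 0 <= V x) (c_ge0 : 0 <= c) (mu_ge0 : 0 <= mu)
  (V_growth : forall (x : 'cV[R]_d) (s : nat), (s <= p)%N ->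
     tensor_hsnorm V s x <= c * (1 + V x) `^ (1 - s%:R * gamma)).

Variables (T h rho : R) (bh : R -> 'cV[R]_d -> 'cV[R]_d)
  (sigmah : R -> 'cV[R]_d -> 'M[R]_(d, m))
  (dO : measure_display) (Omega : measurableType dO)
  (P : probability Omega R) (F : R -> set (set Omega))
  (W : R -> Omega -> 'cV[R]_m) (X0 : Omega -> 'cV[R]_d).
Hypotheses (h_gt0 : 0 < h) (h_le1 : h <= 1) (rho_gt0 : 0 < rho)
  (mbh : measurable_fun (`[0, T] `*` [set: borelMx R d 1])
    (fun z : R * borelMx R d 1 => bh z.1 z.2 : borelMx R d 1))
  (msigmah : measurable_fun (`[0, T] `*` [set: borelMx R d 1])
    (fun z : R * borelMx R d 1 => sigmah z.1 z.2 : borelMx R d m))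
  (F_filtration : filtration F) (W_wiener : wiener_process P F W)
  (X0_F0 : measurable_wrt (F 0) X0)
  (generator_le : forall (t : R) (x : 'cV[R]_d), 0 <= t <= T ->
     generator bh sigmah V t x <= rho * (1 + V x))
  (tamed : forall (t : R) (x : 'cV[R]_d), 0 <= t <= T ->
     Num.max (hsnorm (bh t x) * h `^ 2^-1) (hsnorm (sigmah t x) * h `^ 4^-1)
       <= mu * (1 + V x) `^ gamma).

Let X k := scheme h bh sigmah W X0 k.
Let t (k : nat) : R := k%:R * h.
Let r : R := h `^ 4^-1.

Let r_gt0 : 0 < r. Proof. exact: powR_gt0. Qed.

Let r_le1 : r <= 1.
Proof.
have q0 : 0 <= 4^-1 :> R by rewrite invr_ge0.
rewrite (_ : 1 = 1 `^ 4^-1); last by rewrite powR1.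
apply: ge0_ler_powR => //; rewrite nnegrE //.
exact: ltW.
Qed.

Let r_sqr : r ^+ 2 = h `^ 2^-1.
Proof.
rewrite /r -(powR_mulrn _ (powR_ge0 _ _)) -powRrM; congr (_ `^ _).
by field.
Qed.

Let r_four : r ^+ 4 = h.
Proof.
rewrite /r -(powR_mulrn _ (powR_ge0 _ _)) -powRrM mulVf //.
by rewrite powRr1 // ltW.
Qed.

Let t_ge0 k : 0 <= t k. Proof. by rewrite mulr_ge0 // ltW. Qed.

Let t_lt k : t k < t k.+1.
Proof. by rewrite /t ltr_pM2r // ltr_nat. Qed.

Let t_diff k : t k.+1 - t k = h.
Proof. by rewrite /t -mulrBl -natrB // subSnn mul1r. Qed.

Let F_sigma k : sigma_algebra setT (F (t k)).
Proof. by case: F_filtration => + _ _; exact. Qed.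

Lemma measurable_section n (f : R -> 'cV[R]_d -> 'M[R]_(d, n)) s i j :
  0 <= s <= T ->
  measurable_fun (`[0, T] `*` [set: borelMx R d 1])
    (fun z : R * borelMx R d 1 => f z.1 z.2 : borelMx R d n) ->
  measurable_fun setT (fun x : borelMx R d 1 => f s x i j : R).
Proof.
move=> s0T mf; apply: (measurableT_comp (measurable_coord i j)).
pose g (x : borelMx R d 1) : R * borelMx R d 1 := (s, x).
apply: (measurable_comp (F := `[0, T] `*` [set: borelMx R d 1]) (g := g) _ _ mf).
- exact: measurableX.
- by move=> _ [x _ <-]; split => //=; rewrite in_itv.
- by apply: measurable_fun_pair => //; exact: measurable_cst.
Qed.

(** Each step combines [X k] with [W] at the times [t k] and [t k.+1], all measurable at time
    [t k.+1]. This is what makes [X k] independent of the next increment. *)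
Lemma scheme_adapted k : t k <= T -> measurable_wrt (F (t k)) (X k).
Proof.
elim: k => [|k IH] tkT; first by rewrite /t mul0r.
have tkT' : t k <= T by exact: le_trans (ltW (t_lt k)) tkT.
have sub : F (t k) `<=` F (t k.+1).
  by case: F_filtration => _ _; apply => //; exact: ltW.
have {IH} mX : measurable_fun setT
    (X k : g_sigma_algebraType (F (t k.+1)) -> borelMx R d 1).
  apply/measurable_wrtP => // B mB; apply: sub; exact: IH.
have t0T : 0 <= t k <= T by rewrite t_ge0.
apply/measurable_wrt_coordP => // i.
have mW j : measurable_fun setT
    (fun w : g_sigma_algebraType (F (t k.+1)) => (W (t k.+1) w - W (t k) w) j 0 : R).
  under eq_fun do rewrite !mxE.
  apply: measurable_funB.
    by move: j; apply/measurable_wrt_coordP => //; exact: (wiener_adapted W_wiener (t_ge0 _)).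
  move: j; apply/measurable_wrt_coordP => // B mB; apply: sub.
  exact: (wiener_adapted W_wiener (t_ge0 _)).
have step := @measurable_affine_step R d m _ (g_sigma_algebraType (F (t k.+1)))
  (X k) (fun w => h *: bh (t k) (X k w)) (fun w => sigmah (t k) (X k w))
  (fun w => W (t k.+1) w - W (t k) w).
have {}step := measurableT_comp (measurable_coord i 0) (step _ _ _ mW).
rewrite (_ : (fun _ => _) = (fun w => (X k w + (h *: bh (t k) (X k w)
   + sigmah (t k) (X k w) *m (W (t k.+1) w - W (t k) w))) i 0)); last first.
  by apply/funext => w; rewrite addrA.
apply: step => [l|l|l l'].
- exact: (measurableT_comp (measurable_coord l 0) mX).
- under eq_fun do rewrite mxE; apply: measurable_funM => //.
  exact: (measurableT_comp (measurable_section l 0 t0T mbh) mX).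
- exact: (measurableT_comp (measurable_section l l' t0T msigmah) mX).
Qed.

Let C : R := @step_const R d m p mu c.

Let rhoC_ge0 : 0 <= h * (rho + C).
Proof. by rewrite mulr_ge0 ?addr_ge0 ?step_const_ge0 // ltW. Qed.

Let F_measurable k : F (t k) `<=` measurable.
Proof. by case: F_filtration => _ + _; exact. Qed.

Let measurable_X k : t k <= T -> measurable_fun setT (X k : Omega -> borelMx R d 1).
Proof.
by move=> tkT; apply: (measurable_wrt_measurable_fun (@F_measurable k)); exact: scheme_adapted.
Qed.

Let measurable_dW k :
  measurable_fun setT ((W (t k.+1) \- W (t k))%R : Omega -> borelMx R m 1).
Proof.
have mW j i : measurable_fun setT (fun w : Omega => W (t j) w i 0).
  apply: (measurableT_comp (measurable_coord i 0)).
  exact: measurable_wrt_measurable_fun (@F_measurable j) (wiener_adapted W_wiener (t_ge0 j)).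
apply: measurable_fun_borelMx => // i j; rewrite ord1.
under eq_fun do rewrite !mxE.
by apply: measurable_funB.
Qed.

Lemma one_step_generator (nu : probability (borelMx R m 1) R) s x :
  0 <= s <= T ->
  (forall B : 'I_m -> set R, (forall i, measurable (B i)) ->
    nu [set z | forall i, B i ((z : 'cV[R]_m) i 0)] =
    (\prod_(i < m) normal_prob 0 (Num.sqrt h) (B i))%E) ->
  (\int[nu]_z (V (x + (h *: bh s x + sigmah s x *m (z : 'cV[R]_m))))%:E
    <= (V x + h * (rho + C) * (1 + V x))%:E)%E.
Proof.
move=> s0T nu_box.
have sqrtE : Num.sqrt h = r ^+ 2 by rewrite r_sqr powR12_sqrt // ltW.
rewrite sqrtE in nu_box.
have := tamed x s0T; rewrite ge_max => /andP[tb ts].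
(* Here [h = r ^+ 2 * r ^+ 2]: one factor is consumed by the taming bound of the drift, the other
   remains. *)
have a_le i : `|(h *: bh s x) i 0| <= r ^+ 2 * (mu * (1 + V x) `^ gamma).
  rewrite mxE normrM (gtr0_norm h_gt0) -{1}r_four (exprM r 2 2) expr2 -mulrA.
  rewrite ler_wpM2l ?sqr_ge0 // (le_trans _ tb) // -r_sqr mulrC.
  by rewrite ler_wpM2r ?sqr_ge0 // hsnorm_coord.
have := one_step_bound p_ge2 V_class V_poly V_ge0 c_ge0 mu_ge0 V_growth
  r_gt0 r_le1 nu_box a_le ts.
move=> /le_trans; apply; rewrite lee_fin r_four -/C.
have := generator_le x s0T; rewrite /generator => gen.
have -> : \sum_(i < d) (h *: bh s x) i 0 * iter_partial V [:: i] x
  = h * \sum_(i < d) gradV V x i 0 * bh s x i 0.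
  by rewrite mulr_sumr; apply: eq_bigr => i _; rewrite !mxE -mulrA [bh _ _ _ _ * _]mulrC.
move: gen; rewrite -(ler_pM2l h_gt0); lra.
Qed.

Local Open Scope ereal_scope.

(** The increment is independent of [X k] and has covariance [h] times the identity, so it is
    integrated out with [X k] frozen; [one_step_generator] then holds pointwise in [X k w]. *)
Lemma one_step_expectation k : (t k <= T)%R ->
  \int[P]_w (1 + V (X k.+1 w))%:E
    <= (1 + h * (rho + C))%:E * \int[P]_w (1 + V (X k w))%:E.
Proof.
move=> tkT; have t0T : (0 <= t k <= T)%R by rewrite t_ge0.
have mV : measurable_fun setT (V : borelMx R d 1 -> R).
  exact: measurable_class_C V_class.
pose dW := ((W (t k.+1) \- W (t k))%R : Omega -> borelMx R m 1).
pose Xm : {mfun Omega >-> borelMx R d 1} :=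
  HB.pack (X k : Omega -> borelMx R d 1)
    (isMeasurableFun.Build _ _ _ _ _ (measurable_X tkT)).
pose Ym : {mfun Omega >-> borelMx R m 1} :=
  HB.pack dW (isMeasurableFun.Build _ _ _ _ _ (@measurable_dW k)).
pose g (x : 'cV[R]_d) (z : 'cV[R]_m) :=
  (x + (h *: bh (t k) x + sigmah (t k) x *m z))%R.
pose f (z : borelMx R d 1 * borelMx R m 1) : \bar R := (1 + V (g z.1 z.2))%:E.
have mg : measurable_fun setT (fun z : borelMx R d 1 * borelMx R m 1 =>
    g z.1 z.2 : borelMx R d 1).
  apply: measurable_affine_step => [i|i|i j|i].
  - exact: (measurableT_comp (measurable_coord i 0%R) measurable_fst).
  - under eq_fun do rewrite mxE; apply: measurable_funM => //.
    exact: (measurableT_comp (measurable_section i 0%R t0T mbh) measurable_fst).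
  - exact: (measurableT_comp (measurable_section i j t0T msigmah) measurable_fst).
  - exact: (measurableT_comp (measurable_coord i 0%R) measurable_snd).
have mf : measurable_fun setT f.
  by apply/measurable_EFinP; apply: measurable_funD => //; exact: measurableT_comp mV mg.
have f0 z : 0 <= f z by rewrite lee_fin addr_ge0.
have indep A B : measurable A -> measurable B ->
    P (Xm @^-1` A `&` Ym @^-1` B) = P (Xm @^-1` A) * P (Ym @^-1` B).
  move=> mA mB; apply: (wiener_indep W_wiener (t_ge0 k) (ltW (t_lt k))) => //.
  exact: scheme_adapted.
have -> : \int[P]_w (1 + V (X k.+1 w))%:E = \int[P]_w f (Xm w, Ym w).
  by apply: eq_integral => w _; rewrite /f /g /= addrA.
rewrite (independent_integral indep mf f0).
have nu_box (B : 'I_m -> set R) : (forall i, measurable (B i)) ->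
    distribution P Ym [set z | forall i, B i ((z : 'cV[R]_m) i 0%R)] =
    \prod_(i < m) normal_prob 0 (Num.sqrt h) (B i).
  by move=> mB; rewrite -(t_diff k) -(wiener_normal W_wiener).
rewrite -ge0_integralZl //; last 3 first.
- apply/measurable_EFinP; apply: measurable_funD => //.
  exact: measurableT_comp mV (measurable_X tkT).
- by move=> w _; rewrite lee_fin addr_ge0.
- by rewrite lee_fin addr_ge0.
apply: ge0_le_integral => //.
- by move=> w _; apply: integral_ge0.
- apply: (measurableT_comp (measurable_fun_fubini_tonelli_F _ mf f0)).
  exact: measurable_funPT.
- apply/measurable_EFinP; apply: measurable_funM => //; apply: measurable_funD => //.
  exact: measurableT_comp mV (measurable_X tkT).
move=> w _; rewrite /f /=.
under eq_integral do rewrite EFinD.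
rewrite ge0_integralD //; last 2 first.
- by move=> z _; rewrite lee_fin.
- apply/measurable_EFinP; apply: (measurableT_comp mV).
  exact: (measurable_fun_pair2 (X k w : borelMx R d 1) mg).
rewrite integral_cst //= probability_setT mule1.
apply: (@le_trans _ _ (1 + (V (X k w) + h * (rho + C) * (1 + V (X k w)))%:E)).
  by apply: leeD => //; exact: one_step_generator t0T nu_box.
rewrite -EFinD -EFinM lee_fin le_eqVlt; apply/orP; left; apply/eqP; ring.
Qed.

(** The one-step factor [1 + h * (rho + C)] is at most [expR (h * (rho + C))], and the exponentials
    multiply along the steps. *)
Lemma scheme_expectation_le k : (t k <= T)%R ->
  \int[P]_w (1 + V (X k w))%:E
    <= (expR (t k * (rho + C)))%:E * \int[P]_w (1 + V (X0 w))%:E.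
Proof.
have V1_ge0 x : 0 <= (1 + V x)%:E by rewrite lee_fin addr_ge0.
elim: k => [|k IH] tkT; first by rewrite /t mul0r mul0r expR0 mul1e.
have {}tkT : (t k <= T)%R by exact: le_trans (ltW (t_lt k)) tkT.
apply: (le_trans (one_step_expectation tkT)).
have -> : (t k.+1 * (rho + C) = h * (rho + C) + t k * (rho + C))%R.
  by rewrite -mulrDl -(t_diff k) subrK.
rewrite expRD EFinM -muleA; apply: lee_pmul => //; last exact: IH.
- by rewrite lee_fin addr_ge0.
- exact: integral_ge0.
- by rewrite lee_fin expR_ge1Dx.
Qed.

End tamed_scheme.

(** * Bound on the expectation of [V] along the scheme, uniform in the step size *)

Theorem theorem2p1 (R : realType) (d m p : nat) (gamma : R)
    (V : 'cV[R]_d -> R) (mu : R)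
    (p_ge2 : (2 <= p)%N)
    (gamma_gt0 : 0 < gamma) (gamma_le : gamma <= p%:R^-1)
    (V_class : hat_calV p gamma V)
    (mu_gt0 : 0 < mu) :
  exists rhot : R,
    forall (T h rho : R)
      (bh : R -> 'cV[R]_d -> 'cV[R]_d)
      (sigmah : R -> 'cV[R]_d -> 'M[R]_(d, m))
      (dO : measure_display) (Omega : measurableType dO)
      (P : probability Omega R) (F : R -> set (set Omega))
      (W : R -> Omega -> 'cV[R]_m) (X0 : Omega -> 'cV[R]_d),
    0 < T -> 0 < h -> h <= 1 -> 0 < rho ->
    measurable_fun (`[0, T] `*` [set: borelMx R d 1])
      (fun z : R * borelMx R d 1 => bh z.1 z.2 : borelMx R d 1) ->
    measurable_fun (`[0, T] `*` [set: borelMx R d 1])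
      (fun z : R * borelMx R d 1 => sigmah z.1 z.2 : borelMx R d m) ->
    measure_is_complete P ->
    filtration F -> right_continuous_filtration F ->
    wiener_process P F W ->
    measurable_wrt (F 0) X0 ->
    ('E_P[(fun w => V (X0 w))] < +oo)%E ->
    (forall (t : R) (x : 'cV[R]_d), 0 <= t <= T ->
      generator bh sigmah V t x <= rho * (1 + V x)) ->
    (forall (t : R) (x : 'cV[R]_d), 0 <= t <= T ->
      Num.max (hsnorm (bh t x) * h `^ 2^-1) (hsnorm (sigmah t x) * h `^ 4^-1)
        <= mu * (1 + V x) `^ gamma) ->
    forall k : nat, (k%:Z <= Num.floor (T / h)) ->
      ('E_P[(fun w => V (scheme h bh sigmah W X0 k w))]
         <= (expR ((rho + rhot) * T))%:E * 'E_P[(fun w => (1 + V (X0 w))%R)]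
         < +oo)%E.
Proof.
have [[V_C V_ge0 _ [c c_gt0 V_growth]] V_poly] := V_class.
(* The constant is fixed before [T], [h], [rho], the coefficients and the stochastic basis; [c] is
   the growth constant of [V]. *)
exists (@step_const R d m p mu c).
move=> T h rho bh sigmah dO Omega P F W X0 T_gt0 h_gt0 h_le1 rho_gt0 mbh msigmah _
  F_filt _ W_wiener X0_F0 EX0 gen tamed k k_le.
have kT : k%:R * h <= T.
  by rewrite -ler_pdivlMr // -[k%:R]/(k%:Z%:~R) -floor_ge_int.
have mV : measurable_fun setT (V : borelMx R d 1 -> R) by exact: measurable_class_C V_C.
have mX j : j%:R * h <= T ->
    measurable_fun setT (fun w => (V (scheme h bh sigmah W X0 j w))%:E).
  move=> jT; apply/measurable_EFinP; apply: (measurableT_comp mV).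
  have [_ Fm _] := F_filt.
  apply: (measurable_wrt_measurable_fun (Fm (j%:R * h) _)).
    by rewrite mulr_ge0 // ltW.
  exact: scheme_adapted mbh msigmah F_filt W_wiener X0_F0 j jT.
have V_ge0' x : (0 <= (V x)%:E)%E by rewrite lee_fin.
have mX0 := mX 0%N; rewrite mul0r in mX0; have {}mX0 := mX0 (ltW T_gt0).
have leE := scheme_expectation_le p_ge2 V_C V_poly V_ge0 (ltW c_gt0) (ltW mu_gt0)
  V_growth h_gt0 h_le1 rho_gt0 mbh msigmah F_filt W_wiener X0_F0 gen tamed kT.
rewrite unlock in EX0 *; apply/andP; split.
  apply: (@le_trans _ _ (\int[P]_w (1 + V (scheme h bh sigmah W X0 k w))%:E)%E).
    apply: ge0_le_integral => //.
    - exact: mX.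
    - by apply/measurable_EFinP; apply: measurable_funD => //; apply/measurable_EFinP; exact: mX.
    - by move=> w _; rewrite lee_fin lerDr.
  apply: (le_trans leE); apply: lee_wpmul2r.
    by apply: integral_ge0 => w _; rewrite lee_fin addr_ge0.
  (* The exponent reached at time [k%:R * h] is enlarged to the one at [T], the rate being
     nonnegative. *)
  rewrite lee_fin ler_expR mulrC; apply: ler_wpM2l => //.
  by rewrite addr_ge0 ?step_const_ge0 // ltW.
apply: lte_mul_pinfty => //.
under eq_integral do rewrite EFinD.
rewrite ge0_integralD //.
rewrite integral_cst //= probability_setT mule1.
by apply: lte_add_pinfty => //; exact: ltry.
Qed.
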